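(* Let $\mathbf{u} = (u(n))_{n=1}^\infty$ be a simple non-degenerate integer linear recurrence sequence of order $d \ge 2$ with a dominant root. Then, for any fixed integer $s \ge 1$, uniformly over integers $M \ge 0$, \[ \mathsf{M}_s(M,N) \ll N^{s - 3/(4d-3) + o(1)}, \] where the implied constant depends only on $s$ and $\mathbf{u}$, and $o(1)$ denotes a quantity tending to $0$ as $N \to \infty$ at a rate depending only on $s$ and $\mathbf{u}$ (and not on $M$).
   Context: An integer linear recurrence sequence of order $d \ge 1$ is a sequence of integers $\mathbf{u} = (u(n))_{n=1}^\infty$ satisfying a relation $u(n+d) = c_{d-1}u(n+d-1) + \cdots + c_0 u(n)$ for all $n = 1, 2, \ldots$, with integer coefficients $c_0, \ldots, c_{d-1}$, and not satisfying any shorter relation of this form. Its characteristic polynomial is $f(X) = X^d - c_{d-1}X^{d-1} - \cdots - c_0 \in \mathbb{Z}[X]$. The sequence is non-degenerate if there are no roots of unity among the ratios of distinct (complex) roots of $f$; here it is understood that these ratios are defined, i.e. $c_0 \ne 0$. The sequence is simple if $f$ has no multiple roots. It has a dominant root if $f$ has a root $\lambda$ with $|\lambda| > \max\{|\mu| : f(\mu) = 0,\ \mu \ne \lambda\}$. Nonzero complex numbers $\gamma_1, \ldots, \gamma_s$ are multiplicatively dependent if there exist integers $k_1, \ldots, k_s$, not all zero, such that $\gamma_1^{k_1} \cdots \gamma_s^{k_s} = 1$. For integers $M \ge 0$, $N \ge 1$, $s \ge 1$, $\mathsf{M}_s(M,N)$ denotes the number of $s$-tuples $(n_1, \ldots,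 n_s) \in (\mathbb{Z} \cap [M+1, M+N])^s$ such that $u(n_1), \ldots, u(n_s)$ (all nonzero) are multiplicatively dependent. The notation $U \ll V$ means $|U| \le cV$ for some constant $c > 0$. *)

(* Defs.v *)
From HB Require Import structures.
From mathcomp Require Import all_boot all_order all_algebra.
From mathcomp Require Import complex.
From mathcomp Require Import all_classical all_reals all_analysis.

Set Implicit Arguments.
Unset Strict Implicit.
Unset Printing Implicit Defensive.

Import Order.TTheory GRing.Theory Num.Theory.
Local Open Scope ring_scope.

(* Sequences are indexed from 1: the value [u 0] plays no role, as all
   conditions on [u] below only involve [u n] for [n >= 1]. *)
Definition satisfies_rec (u : nat -> int) (d : nat) (c : 'I_d -> int) : Prop :=
  forall n : nat, (1 <= n)%N ->
    u (n + d)%N = \sum_(i < d) c i * u (n + i)%N.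

Definition int_lrs_of_order (u : nat -> int) (d : nat) (c : 'I_d -> int) :
    Prop :=
  [/\ (1 <= d)%N,
      satisfies_rec u c &
      forall (e : nat) (c' : 'I_e -> int),
        (1 <= e < d)%N -> ~ satisfies_rec u c'].

Definition char_polynomial (d : nat) (c : 'I_d -> int) : {poly int} :=
  'X^d - \sum_(i < d) c i *: 'X^i.

Definition complex_poly (R : rcfType) (f : {poly int}) : {poly R[i]} :=
  map_poly intr f.

Definition simple_poly (R : rcfType) (f : {poly int}) : Prop :=
  forall z : R[i], (mup z (complex_poly R f) <= 1)%N.

(* [f`_0 != 0] says that all the roots of [f] are nonzero, so that their
   ratios are defined; for [f := char_polynomial c] it reads [c_0 != 0]. *)
Definition non_degenerate_poly (R : rcfType) (f : {poly int}) : Prop :=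
  f`_0 != 0 /\
  forall z w : R[i],
    root (complex_poly R f) z -> root (complex_poly R f) w -> z != w ->
    ~ exists2 m : nat, (0 < m)%N & m.-unity_root (z / w).

Definition has_dominant_root (R : rcfType) (f : {poly int}) : Prop :=
  exists2 l : R[i], root (complex_poly R f) l &
    forall w : R[i], root (complex_poly R f) w -> w != l -> `|w| < `|l|.

Definition mult_dependent (F : fieldType) (s : nat) (g : 'I_s -> F) : Prop :=
  (forall i, g i != 0) /\
  exists2 k : 'I_s -> int, (exists i, k i != 0) & \prod_(i < s) g i ^ k i = 1.

(* The type ['I_(M + N).+1] provides the bound [n i <= M + N]. *)
Definition num_mult_dependent (R : rcfType) (u : nat -> int) (s M N : nat) :
    nat :=
  #|[set n : {ffun 'I_s -> 'I_(M + N).+1} |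
      [forall i, (M + 1 <= n i)%N] &&
      `[< mult_dependent (fun i => (u (n i))%:~R : R[i]) >] ]|.

(* Main.v *)
(* If prod_i u(n_i)^(k_i) = 1 and |k_i| is maximal, comparing valuations shows that
   u(n_i) divides the product of the other u(n_j). Let q(n) be the part of u(n)
   prime to c_0. Apart from O(log N) values n_i, the integer q(n_i) is
   exponentially large, so some gcd(q(n_i), q(n_j)) is at least q(n_i)^(1/s). For
   a given n_i this leaves O(1) values n_j in every interval of length
   proportional to n_i. Summing over n_i gives a bound O(N^(s-1) log N), and
   3/(4d-3) <= 3/5.

   The input about recurrences is that more than B (a constant) terms
   u(y) with y in [n_0, n_0 + H] determine the whole sequence: d of them are related
   to u(n_0), ..., u(n_0+d-1) by an integer matrix of nonzero determinant
   D = exp(O(H)), because a nonzero recurrence with the same non-degenerate simple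
   characteristic polynomial has at most B zeros (a p-adic argument in the style of
   Skolem and Strassman). Hence a common divisor m of these terms satisfies
   m^d | D^d det(u(n_0+i+j)), where the Hankel determinant is Delta c_0^(n_0-1) up
   to sign with Delta <> 0, and these terms are not all small. As |c_0| < |lambda|^d
   for the dominant root lambda, this bounds both the part of u(n) supported at
   primes dividing c_0 and the common divisors prime to c_0. *)
Require Import Defs.
From HB Require Import structures.
From mathcomp Require Import all_boot all_order all_algebra all_fingroup.
From mathcomp Require Import complex.
From mathcomp Require Import all_classical all_reals all_analysis.
From mathcomp Require Import zify ring lra.

Set Implicit Arguments.
Unset Strict Implicit.
Unset Printing Implicit Defensive.

Import Order.TTheory GRing.Theory Num.Theory.
Import numFieldNormedType.Exports.
Local Open Scope ring_scope.

(** * p-adic bound for the zeros of a recurrence *)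

(** Legendre's formula compared with a geometric series; the induction carries the last term
    [m %/ p ^ n], so that the partial sums telescope. *)
Lemma logn_fact_leq p m : prime p -> (p.-1 * logn p m`! <= m)%N.
Proof.
move=> p_pr; rewrite logn_fact //.
suff H n : (p.-1 * (\sum_(1 <= k < n.+1) m %/ p ^ k) + m %/ p ^ n <= m)%N.
  by apply: leq_trans (H m); rewrite leq_addr.
elim: n => [|n IH]; first by rewrite big_geq // muln0 add0n divn1.
rewrite big_nat_recr //=; apply: leq_trans IH.
rewrite mulnDr -addnA leq_add2l -mulSnr prednK ?prime_gt0 //.
by rewrite mulnC expnSr divnMA leq_divM.
Qed.

(** Division by [X - a] gives a quotient with [G_j = F_(j+1) + a G_(j+1)]. Descending from the
    degree, [q] divides a tail of [G] that starts one place lower, which matches the loss of one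
    root. *)
Lemma dvdz_coef_of_roots (q : int) (rs : seq int) (F : {poly int}) :
  uniq rs -> all (root F) rs ->
  (forall i, (size rs <= i)%N -> (q %| F`_i)%Z) -> forall i, (q %| F`_i)%Z.
Proof.
elim: rs F => [|a rs IH] F /=; first by move=> _ _ H i; apply: H.
move=> /andP[ars urs] /andP[Fa Frs] H.
have [G FG] := factor_theorem F a Fa.
have coefF i : F`_i = (if i is j.+1 then G`_j else 0) - a * G`_i.
  by rewrite FG mulrBr coefB coefMX coefMC mulrC; case: i.
have Gtail k j : (size G <= j + k)%N -> (size rs <= j)%N -> (q %| G`_j)%Z.
  elim: k j => [|k IHk] j; first by rewrite addn0 => /(nth_default 0)->.
  rewrite addnS -addSn => sG sj.
  have -> : G`_j = F`_j.+1 + a * G`_j.+1 by rewrite coefF subrK.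
  by rewrite rpredD ?H // dvdz_mull ?IHk // ltnW.
have Gall i : (q %| G`_i)%Z.
  apply: IH => // [|j]; last by move=> /(Gtail (size G)) -> //; rewrite leq_addl.
  apply/allP => b brs; have := allP Frs b brs; rewrite FG rootM root_XsubC.
  by case/orP => // /eqP ba; rewrite -ba brs in ars.
move=> i; rewrite coefF; apply: rpredB; last exact: dvdz_mull.
by case: i => [|i] //; apply: dvdz0.
Qed.

Lemma fact_dvdn_fact m n : (m <= n)%N -> (m`! %| n`!)%N.
Proof. by move=> /bin_fact <-; rewrite dvdn_mull // dvdn_mulr. Qed.

Definition ffact_poly (m : nat) : {poly int} := \prod_(i < m) ('X - (i%:R)%:P).

Lemma ffact_poly_monic m : ffact_poly m \is monic.
Proof. by apply: monic_prod => i _; apply: monicXsubC. Qed.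

Lemma size_ffact_poly m : size (ffact_poly m) = m.+1.
Proof.
by rewrite size_prod_XsubC -[index_enum _]enumT size_enum_ord.
Qed.

Lemma horner_ffact_poly m (j : nat) : (ffact_poly m).[j%:R] = (j ^_ m)%:R.
Proof.
rewrite /ffact_poly horner_prod ffact_prod natr_prod.
have [jm|mj] := ltnP j m.
  rewrite (bigD1 (Ordinal jm)) //= !hornerE subrr mul0r.
  by rewrite (bigD1 (Ordinal jm)) //= subnn mul0r.
by apply: eq_bigr => i _; rewrite !hornerE natrB // (leq_trans (ltnW (ltn_ord i))).
Qed.

(** The falling factorials are monic of degree [m], so the top coefficient of the sum is the last
    [a m] and can be peeled off. *)
Lemma dvdz_ffact_coef (q : int) (a : nat -> int) M :
  (forall i, (q %| (\sum_(m < M) a m *: ffact_poly m)`_i)%Z) ->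
  forall m, (m < M)%N -> (q %| a m)%Z.
Proof.
elim: M => // M IH H.
have aM : (q %| a M)%Z.
  have := H M; rewrite big_ord_recr coefD coefZ coef_sum big1 /= => [|i _].
    have := monicP (ffact_poly_monic M); rewrite /lead_coef size_ffact_poly => ->.
    by rewrite add0r mulr1.
  by rewrite coefZ nth_default ?mulr0 // size_ffact_poly.
move=> m; rewrite ltnS leq_eqVlt => /predU1P[->|] //.
apply: IH => i; have := H i; rewrite big_ord_recr coefD coefZ /= => Hi.
by rewrite -(addrK (a M * (ffact_poly M)`_i) (_`_i)) rpredB // dvdz_mulr.
Qed.

(* A Strassman-type bound. Clearing denominators turns the Newton
   series into an integral polynomial with the zeros [js]; since [p ^ m / m!] is
   divisible by [p ^ d] for [m >= d], divisibility of the tail propagates to the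
   first [d] coefficients and then, by [rec], to all of them: infinite descent. *)
Lemma padic_zeros (p d : nat) (b : nat -> int) (js : seq nat) :
  prime p -> (d.+1 < p)%N -> uniq js -> (d <= size js)%N ->
  (forall t, (forall m, (m < d)%N -> ((p ^ t)%N %| b m)%Z) ->
     forall m, ((p ^ t)%N %| b m)%Z) ->
  (forall j, j \in js -> \sum_(m < j.+1) ('C(j, m) * p ^ m)%:R * b m = 0) ->
  forall m, b m = 0.
Proof.
move=> p_pr dp ujs sjs rec zero.
suff H t m : ((p ^ t)%N %| b m)%Z.
  move=> m; apply/eqP; have := H `|b m|%N m.
  rewrite dvdzE absz_nat -absz_eq0; case: posnP => // b0 /(dvdn_leq b0).
  by rewrite leqNgt ltn_expl ?prime_gt1.
elim: t m => [|t IH]; first by move=> m; rewrite dvd1z.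
apply: rec.
pose M := (d + (\max_(j <- js) j)%N.+1)%N.
have jM j : j \in js -> (j < M)%N.
  move=> jjs; rewrite /M addnS ltnS (leq_trans _ (leq_addl _ _)) //.
  exact: (@leq_bigmax_seq _ _ xpredT id).
(* Multiplication by the factorial of [M] clears the denominators of the Newton series. As [M]
   exceeds every element of [js], no term is lost at these points and [F] vanishes there. *)
pose a m := (M`! %/ m`! * p ^ m)%:R * b m.
pose F := \sum_(m < M) a m *: ffact_poly m.
have Froot j : j \in js -> root F j%:R.
  move=> jjs; apply/rootP; rewrite /F horner_sum.
  rewrite (bigID (fun i : 'I_M => (i < j.+1)%N)) /= addrC big1 => [|i]; last first.
    by rewrite -leqNgt => ji; rewrite hornerZ horner_ffact_poly ffact_small ?mulr0.
  rewrite add0r -(big_ord_widen M (fun m => (a m *: ffact_poly m).[j%:R])) ?jM //.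
  transitivity (M`!%:R * \sum_(m < j.+1) ('C(j, m) * p ^ m)%:R * b m); last first.
    by rewrite zero ?mulr0.
  rewrite mulr_sumr; apply: eq_bigr => m _.
  rewrite hornerZ horner_ffact_poly /a -bin_ffact.
  have mM : (m <= M)%N by rewrite (leq_trans _ (ltnW (jM j jjs))) // -ltnS.
  rewrite -[in RHS](divnK (fact_dvdn_fact mM)) !natrM; ring.
(* For [m >= d] the valuation of [a m] is at least [V + t + d], by the induction hypothesis and
   [m - v(m!) >= d]. For [m < d] the factor in front of [b m] has valuation only [V + m], which
   leaves at least [t + 1] to [b m]. *)
pose V := logn p M`!; pose q := (p ^ (V + t + d))%N.
have logVm m : (m <= M)%N -> logn p (M`! %/ m`!) = (V - logn p m`!)%N.
  by move=> mM; rewrite logn_div // fact_dvdn_fact.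
have fact_gt m : (m <= M)%N -> (0 < M`! %/ m`!)%N.
  by move=> mM; rewrite divn_gt0 ?fact_gt0 // dvdn_leq ?fact_gt0 ?fact_dvdn_fact.
have qF i : (q %| F`_i)%Z.
  apply: (@dvdz_coef_of_roots q [seq j%:R | j <- js]) => //.
  - by rewrite map_inj_uniq // => x y /eqP; rewrite eqr_nat => /eqP.
  - by apply/allP => _ /mapP[j /Froot ? ->].
  move=> {}i; rewrite size_map => si; rewrite /F coef_sum; apply: rpred_sum => m _.
  rewrite coefZ; have [mi|im] := ltnP m i.
    by rewrite nth_default ?mulr0 ?dvdz0 // size_ffact_poly.
  apply: dvdz_mulr; rewrite /a.
  have dm : (d <= m)%N by lia.
  have -> : q = (p ^ (V + d) * p ^ t)%N by rewrite /q -expnD; congr (_ ^ _)%N; lia.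
  rewrite PoszM dvdz_mul ?IH // natz dvdzE !absz_nat.
  have fm := fact_gt _ (ltnW (ltn_ord m)).
  rewrite pfactor_dvdn ?muln_gt0 ?fm ?expn_gt0 ?prime_gt0 //.
  rewrite lognM ?fm ?expn_gt0 ?prime_gt0 //.
  rewrite logVm ?(ltnW (ltn_ord m)) // (pfactorK _ p_pr).
  have := logn_fact_leq m p_pr.
  have : (logn p m`! <= V)%N.
    by rewrite dvdn_leq_log ?fact_gt0 // fact_dvdn_fact // ltnW.
  move: (logn p m`!) => v; have : (d.+1 <= p.-1)%N by lia.
  move: (p.-1) => r dr vV rvm; have : (v * d.+1 <= m)%N by nia.
  by case: v vV {rvm} => [|v] vV; nia.
have qa := dvdz_ffact_coef qF.
move=> m md.
have mM : (m < M)%N by rewrite /M; lia.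
have := qa m mM; rewrite /a !dvdzE abszM !absz_nat natz absz_nat.
have [->|bm0] := posnP `|b m|%N; first by rewrite dvdn0.
have fm := fact_gt _ (ltnW mM).
have vm : logn p m`! = 0%N.
  have := logn_fact_leq m p_pr; case: (logn p _) => // v; nia.
rewrite !pfactor_dvdn ?muln_gt0 ?fm ?bm0 ?expn_gt0 ?prime_gt0 ?bm0 //.
rewrite !lognM ?muln_gt0 ?fm ?bm0 ?expn_gt0 ?prime_gt0 //.
rewrite logVm ?(ltnW mM) // (pfactorK _ p_pr) vm; lia.
Qed.

(* The companion matrix acts on windows of a solution by shifting them, so that
   its powers express every term through the first [n.+1] ones. *)
Definition comp_mx n (c : 'I_n.+1 -> int) : 'M[int]_n.+1 :=
  \matrix_(i, j) (if i == ord_max then c j else (j == i.+1 :> nat)%:R).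

Definition window n (u : nat -> int) k : 'cV[int]_n.+1 := \col_i u (k + i)%N.

Lemma det_comp_mx n (c : 'I_n.+1 -> int) : `|\det (comp_mx c)| = `|c ord0|.
Proof.
rewrite (expand_det_col _ ord0) (bigD1 ord_max) //= big1 => [|i im].
  rewrite addr0 mxE eqxx normrM /cofactor normrM normr_sign mul1r.
  have -> : row' ord_max (col' ord0 (comp_mx c)) = 1%:M; last by rewrite det1 normr1 mulr1.
  apply/matrixP => i j; rewrite !mxE ifF; last by apply/negP => /eqP; apply/eqP; rewrite eq_sym neq_lift.
  by rewrite lift0 /= /bump leqNgt ltn_ord add0n eqSS eq_sym.
by rewrite mxE (negPf im) mul0r.
Qed.

Lemma comp_mx_window n (c : 'I_n.+1 -> int) (u : nat -> int) k :
  u (k + n.+1)%N = \sum_(i < n.+1) c i * u (k + i)%N ->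
  comp_mx c *m window n u k = window n u k.+1.
Proof.
move=> uk; apply/colP => i; rewrite !mxE.
have [->|im] := eqVneq i ord_max.
  rewrite addSnnS uk; by apply: eq_bigr => j _; rewrite !mxE eqxx.
have iSn : (i.+1 < n.+1)%N.
  by rewrite ltn_neqAle ltn_ord andbT eqSS; apply: contra im => /eqP e; apply/eqP/val_inj.
rewrite (bigD1 (Ordinal iSn)) //= big1 => [|j ji]; rewrite !mxE (negPf im) /=.
  by rewrite eqxx mul1r addr0 addSnnS.
by rewrite (_ : (j == i.+1 :> nat) = false) ?mul0r //; apply/negbTE.
Qed.

Lemma comp_mx_window_iter n (c : 'I_n.+1 -> int) (u : nat -> int) k0 k j :
  (forall l, (k0 <= l)%N -> u (l + n.+1)%N = \sum_(i < n.+1) c i * u (l + i)%N) ->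
  (k0 <= k)%N -> comp_mx c ^+ j *m window n u k = window n u (k + j)%N.
Proof.
move=> urec kk; elim: j => [|j IH]; first by rewrite addn0 expr0 mul1mx.
by rewrite exprS -mulmxA IH addnS comp_mx_window //; apply/urec/(leq_trans kk)/leq_addr.
Qed.

Lemma Vandermonde_unitmx (F : fieldType) n (z : 'I_n -> F) :
  injective z -> Vandermonde n (\row_j z j) \in unitmx.
Proof.
move=> zinj; rewrite unitmxE det_Vandermonde unitfE; apply/prodf_neq0 => i _.
apply/prodf_neq0 => l il; rewrite !mxE subr_eq0; apply: contraTneq il => /zinj ->.
by rewrite ltnn.
Qed.

Lemma vandermonde_vanish (F : fieldType) n (z : 'I_n -> F) (a : 'I_n -> F) :
  injective z -> (forall i, (i < n)%N -> \sum_j a j * z j ^+ i = 0) ->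
  forall j, a j = 0.
Proof.
move=> zinj H j.
have Vu := Vandermonde_unitmx zinj.
suff: \col_j a j = 0 by move/colP/(_ j); rewrite !mxE.
rewrite -(mulKmx Vu (\col_j a j)) (_ : _ *m \col_j a j = 0) ?mulmx0 //.
apply/colP => i; rewrite !mxE -[RHS](H i) //; apply: eq_bigr => l _.
by rewrite !mxE mulrC.
Qed.

(** The [a j] solve the Vandermonde system given by the first [n.+1] terms; both sides then satisfy
    the same recurrence. *)
Lemma rec_explicit (F : fieldType) n (c z : 'I_n.+1 -> F) (w : nat -> F) :
  injective z -> (forall j, z j ^+ n.+1 = \sum_i c i * z j ^+ i) ->
  (forall k, w (k + n.+1)%N = \sum_i c i * w (k + i)%N) ->
  exists a : 'I_n.+1 -> F, forall k, w k = \sum_j a j * z j ^+ k.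
Proof.
move=> zinj zrec wrec.
have Vu := Vandermonde_unitmx zinj.
pose a := invmx (Vandermonde n.+1 (\row_j z j)) *m \col_i w i.
exists (fun j => a j 0) => k.
elim/ltn_ind: k => k IH; have [kn|nk] := ltnP k n.+1.
  have /colP/(_ (Ordinal kn)) := mulKVmx Vu (\col_i w i).
  by rewrite !mxE => <-; apply: eq_bigr => j _; rewrite !mxE mulrC.
rewrite -(subnK nk) wrec.
under eq_bigr => i _.
  rewrite IH; last by have := ltn_ord i; lia.
  rewrite mulr_sumr; over.
rewrite exchange_big; apply: eq_bigr => j _ /=.
rewrite exprD zrec mulrA mulr_sumr; apply: eq_bigr => i _; rewrite exprD; ring.
Qed.

(** Along the progression the sequence is an exponential sum with the distinct bases [z j ^+ T], so
    Vandermonde kills the coefficients [a j * z j ^+ r]. *)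
Lemma rec_vanish_progression (F : fieldType) n (c z : 'I_n.+1 -> F) (w : nat -> F) T r :
  injective z -> (forall j, z j ^+ n.+1 = \sum_i c i * z j ^+ i) ->
  (forall j, z j != 0) -> injective (fun j => z j ^+ T) ->
  (forall k, w (k + n.+1)%N = \sum_i c i * w (k + i)%N) ->
  (forall j, w (r + T * j)%N = 0) -> forall k, w k = 0.
Proof.
move=> zinj zrec z0 zT wrec wz k.
have [a wa] := rec_explicit zinj zrec wrec.
have H := @vandermonde_vanish F n.+1 (fun j => z j ^+ T) (fun j => a j * z j ^+ r) zT.
rewrite wa big1 // => j _.
suff /eqP : a j * z j ^+ r = 0.
  by rewrite mulf_eq0 expf_eq0 (negPf (z0 j)) andbF orbF => /eqP->; rewrite mul0r.
apply: H => i _; rewrite -[RHS](wz i) wa; apply: eq_bigr => l _.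
by rewrite exprD exprM mulrA.
Qed.

(** Modulo [p] the matrix lies in a finite general linear group; [T] is its order there. *)
Lemma mx_unit_mod_prime n p (M : 'M[int]_n.+1) : prime p ->
  ~~ (p%:Z %| \det M)%Z ->
  exists2 T, (0 < T)%N & exists Y : 'M[int]_n.+1, M ^+ T = 1 + p%:R *: Y.
Proof.
move=> p_pr pM.
have pcharFp : p \in [pchar 'F_p] by apply: pchar_Fp.
pose Mp : 'M['F_p]_n.+1 := map_mx intr M.
have uM : Mp \is a GRing.unit.
  rewrite -[_ \is a _]/(Mp \in unitmx) unitmxE /Mp det_map_mx unitfE.
  by rewrite (dvdz_pcharf pcharFp) in pM.
pose g := FinRing.unit 'M['F_p]_n.+1 uM.
exists #[g]%g; first exact: order_gt0.
have e1 : Mp ^+ #[g]%g = 1.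
  by have := congr1 (@FinRing.uval _) (expg_order g); rewrite FinRing.val_unitX FinRing.val_unit1.
exists (map_mx (fun x => (x %/ p)%Z) (M ^+ #[g]%g - 1)).
apply/matrixP => i j; rewrite mxE [X in _ + X]mxE mxE.
set x := fun_of_matrix (M ^+ #[g]%g - 1) i j.
have px : (p%:Z %| x)%Z.
  rewrite (dvdz_pcharf pcharFp) /x.
  have /matrixP/(_ i j)/eqP : map_mx intr (M ^+ #[g]%g - 1) = 0 :> 'M['F_p]_n.+1.
    by rewrite map_mxB map_mx1 rmorphXn /= -/Mp e1 subrr.
  by rewrite !mxE.
by rewrite mxE -/x natz mulrC divzK // /x !mxE addrC subrK.
Qed.

(* By Cayley-Hamilton the sequence satisfies a monic integral recurrence. *)
Lemma dvdz_mx_seq n (Y L : 'M[int]_n.+1) (x : 'cV[int]_n.+1) (q : int) :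
  (forall m, (m < n.+1)%N -> (q %| ((L * Y ^+ m) *m x) ord0 ord0)%Z) ->
  forall m, (q %| ((L * Y ^+ m) *m x) ord0 ord0)%Z.
Proof.
move=> H m; elim/ltn_ind: m => m IH; have [|mn] := ltnP m n.+1; first exact: H.
have CH : Y ^+ n.+1 = - \sum_(i < n.+1) (char_poly Y)`_i *: Y ^+ i.
  have := Cayley_Hamilton Y; rewrite -[X in horner_mx _ X]coefK poly_def raddf_sum /= size_char_poly.
  under eq_bigr => i _ do rewrite horner_mxZ rmorphXn /= horner_mx_X.
  rewrite big_ord_recr /=; have := monicP (char_poly_monic Y).
  rewrite /lead_coef size_char_poly => ->; rewrite scale1r => /eqP.
  by rewrite addrC addr_eq0 => /eqP.
rewrite -(subnK mn) exprD CH mulrN mulr_sumr mulrN mulNmx mxE rpredN.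
rewrite mulr_sumr mulmx_suml summxE; apply: rpred_sum => i _.
rewrite -scalerAr -exprD -scalerAr -scalemxAl mxE dvdz_mull // IH //.
by have := ltn_ord i; lia.
Qed.

(** The binomial expansion of [(1 + p Y) ^ j] is a Newton series in [j], of the shape that
    [padic_zeros] handles. *)
Lemma comp_mx_expand n T (M Y : 'M[int]_n.+1) (x : 'cV[int]_n.+1) p r j :
  M ^+ T = 1 + p%:R *: Y ->
  (M ^+ (r + T * j) *m x) ord0 ord0 =
  \sum_(m < j.+1) ('C(j, m) * p ^ m)%:R * ((M ^+ r * Y ^+ m) *m x) ord0 ord0.
Proof.
move=> MT; rewrite exprD exprM MT addrC exprDn_comm; last exact: commr1.
rewrite mulr_sumr mulmx_suml summxE (reindex_inj rev_ord_inj) /=.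
apply: eq_bigr => m _; have mj : (m <= j)%N by rewrite -ltnS ltn_ord.
rewrite subSS (bin_sub mj) (subKn mj) expr1n mulr1.
rewrite exprZn -scaler_nat scalerA -scalerAr -scalemxAl mxE natrM natrX; congr (_ * _); ring.
Qed.

Lemma pigeonhole_mod (T d : nat) (ks : seq nat) :
  (0 < T)%N -> uniq ks -> (T * d < size ks)%N ->
  exists r, exists js, [/\ uniq js, (d <= size js)%N &
    forall j, j \in js -> (r + T * j)%N \in ks].
Proof.
move=> T0 uks sks; have [/existsP[r dr]|] := boolP [exists r : 'I_T, d <= count (fun k => k %% T == r)%N ks]%N.
  exists r, [seq k %/ T | k <- ks & k %% T == r]%N; split.
  - rewrite map_inj_in_uniq ?filter_uniq // => a b.
    rewrite !mem_filter => /andP[/eqP ar _] /andP[/eqP br _] ab.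
    by rewrite (divn_eq a T) (divn_eq b T) ar br ab.
  - by rewrite size_map size_filter.
  move=> j /mapP[k]; rewrite mem_filter => /andP[/eqP kr kks] ->.
  by rewrite -kr addnC mulnC -divn_eq.
rewrite negb_exists => /forallP H; suff : (size ks <= T * d)%N by lia.
have <- : (\sum_(r < T) count (fun k => k %% T == r)%N ks)%N = size ks.
  under eq_bigr do rewrite -sum1_count.
  rewrite (exchange_big_dep xpredT) //= -sum1_size; apply: eq_bigr => k _.
  by rewrite (big_pred1 (Ordinal (ltn_pmod k T0))) // => r; rewrite /= -val_eqE /= eq_sym.
rewrite -[X in (_ <= X * _)%N]card_ord -sum_nat_const; apply: leq_sum => r _.
by have := H r; rewrite -ltnNge => /ltnW.
Qed.

(* For a prime [p] not dividing [c ord0], some power [T] of the companion matrix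
   is [1 + p Y]; in each class modulo [T] the terms are a [p]-adically convergent
   Newton series, so that [n.+1] zeros in a class kill the whole class. *)
Lemma rec_zeros_bound (F : numFieldType) n (c : 'I_n.+1 -> int) (z : 'I_n.+1 -> F) :
  c ord0 != 0 -> injective z ->
  (forall j, z j ^+ n.+1 = \sum_i (c i)%:~R * z j ^+ i) ->
  (forall i j m, (0 < m)%N -> z i ^+ m = z j ^+ m -> i = j) ->
  exists B, forall (w : nat -> int) (ks : seq nat),
    (forall k, w (k + n.+1)%N = \sum_i c i * w (k + i)%N) ->
    uniq ks -> (B < size ks)%N -> (forall k, k \in ks -> w k = 0) ->
    forall k, w k = 0.
Proof.
move=> c0 zinj zrec zT.
(* [p > n.+2] is what [padic_zeros] asks for, and [p > |c ord0|] makes the companion matrix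
   invertible modulo [p]. *)
have [p pb p_pr] := prime_above (n.+2 + `|c ord0|)%N.
have pdet : ~~ (p%:Z %| \det (comp_mx c))%Z.
  have e : `|\det (comp_mx c)|%N = `|c ord0|%N.
    by have := det_comp_mx c; rewrite -!abszE => -[].
  rewrite dvdzE absz_nat e; apply/negP => /dvdn_leq.
  by rewrite absz_gt0 => /(_ c0); lia.
have [T T0 [Y AT]] := mx_unit_mod_prime p_pr pdet.
exists (T * n.+1)%N => w ks wrec uks sks wks.
have [r [js [ujs sjs jks]]] := pigeonhole_mod T0 uks sks.
have wE k : w k = (comp_mx c ^+ k *m window n w 0) ord0 ord0.
  by rewrite (@comp_mx_window_iter _ _ _ 0) // mxE addn0.
have Hb := @padic_zeros p n.+1
  (fun m => (comp_mx c ^+ r * Y ^+ m *m window n w 0) ord0 ord0) js.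
have b0 m : (comp_mx c ^+ r * Y ^+ m *m window n w 0) ord0 ord0 = 0.
  apply: Hb => // [|t Ht|j jjs]; first by lia.
  - exact: dvdz_mx_seq.
  by rewrite -(comp_mx_expand _ _ _ AT) -wE wks // jks.
have z0 j : z j != 0.
  apply/eqP => zj0; have := zrec j; rewrite zj0 expr0n /= (bigD1 ord0) //= big1.
    by move=> /eqP; rewrite expr0 mulr1 addr0 eq_sym intr_eq0 (negPf c0).
  move=> i i0; rewrite expr0n; case: eqP => [e|_]; last by rewrite mulr0.
  by case/negP: i0; apply/eqP/val_inj.
move=> k; apply/eqP; rewrite -(@intr_eq0 F); apply/eqP.
apply: (@rec_vanish_progression F n (fun i => (c i)%:~R) z (fun k => (w k)%:~R) T r) => //.
- by move=> i j /zT ->.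
- move=> {}k; rewrite wrec rmorph_sum /=; apply: eq_bigr => i _; by rewrite rmorphM.
by move=> j; rewrite wE (comp_mx_expand _ _ _ AT) big1 // => m _; rewrite b0 mulr0.
Qed.

(** * Integer relations among the terms of an interval *)

Lemma window_of_iter n (c : 'I_n.+1 -> int) (x : 'cV[int]_n.+1) k (i : 'I_n.+1) :
  (comp_mx c ^+ k *m x) i ord0 = (comp_mx c ^+ (k + i) *m x) ord0 ord0.
Proof.
case: i => i; elim: i k => [|i IH] k ilt.
  by rewrite addn0; congr (_ _ ord0); apply: val_inj.
rewrite /= addnS -addSn -(IH k.+1 (ltnW ilt)) exprS -mulmxA.
have im : Ordinal (ltnW ilt) != ord_max by rewrite -val_eqE /= ltn_eqF.
rewrite [in RHS]mxE (bigD1 (Ordinal ilt)) //= big1 => [|j ji]; rewrite [comp_mx _ _ _]mxE (negPf im) /=.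
  by rewrite eqxx mul1r addr0.
by rewrite (_ : (j == i.+1 :> nat) = false) ?mul0r //; apply/negbTE.
Qed.

(** Every row of the companion matrix but the last is a shift, so any integral column [x] is the
    initial window of a solution. This turns kernel vectors into recurrences. *)
Lemma iter_comp_mx_rec n (c : 'I_n.+1 -> int) (x : 'cV[int]_n.+1) k :
  let w j := (comp_mx c ^+ j *m x) ord0 ord0 in
  w (k + n.+1)%N = \sum_i c i * w (k + i)%N.
Proof.
move=> w; rewrite /w addnS -addSn -[n in (_ + n)%N]/(val (@ord_max n)).
rewrite -window_of_iter exprS -mulmxA mxE; apply: eq_bigr => j _.
by rewrite [comp_mx _ _ _]mxE eqxx window_of_iter.
Qed.

Lemma rat_col_scale m (x : 'cV[rat]_m) :
  exists2 a : int, a != 0 & exists y : 'cV[int]_m, a%:~R *: x = map_mx intr y.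
Proof.
exists (\prod_j denq (x j 0)); first by apply/prodf_neq0 => j _; apply: denq_neq0.
exists (\col_i (numq (x i 0) * \prod_(j | j != i) denq (x j 0))).
apply/colP => i; rewrite !mxE (bigD1 i) //= !rmorphM /= numqE.
by rewrite mulrAC [_ * x i 0]mulrC.
Qed.

Lemma norm_det_le m (M : 'M[int]_m) (b : int) :
  (forall i j, `|M i j| <= b) -> `|\det M| <= (m`!)%:R * b ^+ m.
Proof.
move=> Mb; apply: le_trans (ler_norm_sum _ _ _) _.
have -> : (m`!)%:R * b ^+ m = \sum_(s : 'S_m) b ^+ m.
  by rewrite sumr_const card_Sn mulr_natl.
apply: ler_sum => s _; rewrite normrM normr_sign mul1r normr_prod.
rewrite -[X in _ ^+ X]card_ord -prodr_const; apply: ler_prod => i _.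
by rewrite normr_ge0 Mb.
Qed.

Lemma norm_mx_exp_le n (M : 'M[int]_n.+1) :
  exists2 L : nat, (0 < L)%N & forall k i j, `|(M ^+ k) i j| <= (L ^ k)%:R.
Proof.
pose a := \sum_i \sum_j `|M i j|.
have Ma i j : `|M i j| <= a.
  rewrite /a (bigD1 i) //= (bigD1 j) //= -addrA lerDl addr_ge0 ?sumr_ge0 // => *.
  by apply: sumr_ge0.
have a0 : 0 <= a by apply: sumr_ge0 => i _; apply: sumr_ge0.
exists (n.+1 * `|a|%N).+1 => // k; elim: k => [|k IH] i j.
  by rewrite expr0 expn0 mxE; case: eqP.
rewrite exprS mxE; apply: le_trans (ler_norm_sum _ _ _) _.
rewrite expnS natrM; apply: (@le_trans _ _ (\sum_(l < n.+1) a * ((n.+1 * `|a|%N).+1 ^ k)%:R)).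
  by apply: ler_sum => l _; rewrite normrM ler_pM.
rewrite -mulr_suml ler_wpM2r ?ler0n // sumr_const card_ord.
by rewrite -[a in a *+ _]gez0_abs //; lia.
Qed.

(* The rows of coefficients of the terms [u y], [y \in ys], span the whole space,
   as a nonzero functional vanishing on all of them would contradict
   [rec_zeros_bound]; [D] and [al] come from Cramer's rule. *)
Lemma span_relations (F : numFieldType) n (c : 'I_n.+1 -> int) (z : 'I_n.+1 -> F) :
  c ord0 != 0 -> injective z ->
  (forall j, z j ^+ n.+1 = \sum_i (c i)%:~R * z j ^+ i) ->
  (forall i j m, (0 < m)%N -> z i ^+ m = z j ^+ m -> i = j) ->
  exists B C : nat, (0 < C)%N /\ forall (u : nat -> int) n0 H (ys : seq nat),
    (forall k, (n0 <= k)%N -> u (k + n.+1)%N = \sum_i c i * u (k + i)%N) ->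
    uniq ys -> (B < size ys)%N -> (forall y, y \in ys -> (n0 <= y <= n0 + H)%N) ->
    exists (D : int) (al : 'I_n.+1 -> 'I_n.+1 -> int) (y : 'I_n.+1 -> nat),
    [/\ D != 0, `|D| <= (C ^ H.+1)%:R, forall l, y l \in ys,
        forall i l, `|al i l| <= (C ^ H.+1)%:R &
        forall i : 'I_n.+1, D * u (n0 + i)%N = \sum_l al i l * u (y l)].
Proof.
move=> c0 zinj zrec zT.
have [B HB] := rec_zeros_bound c0 zinj zrec zT.
have [L L0 HL] := norm_mx_exp_le (comp_mx c).
exists B, ((n.+1)`! * L ^ n.+1)%N; split.
  by rewrite muln_gt0 fact_gt0 expn_gt0 L0.
move=> u n0 H ys urec uys sys ysI; set C := (_ * _)%N.
pose m := size ys; pose yy (l : 'I_m) := nth 0%N ys l.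
have yyin l : yy l \in ys by apply: mem_nth.
have yyI l : (yy l - n0 <= H)%N by have := ysI _ (yyin l); lia.
(* Row [l] writes [u (yy l)] as a linear form in the window of [u] at [n0]. *)
pose E : 'M[int]_(m, n.+1) := \matrix_(l, j) (comp_mx c ^+ (yy l - n0)) ord0 j.
have full : row_full (map_mx (intr : int -> rat) E).
  rewrite -cokermx_eq0; set K := cokermx _; apply/eqP/matrixP => i0 j0.
  rewrite [RHS]mxE; have [a a0 [x ax]] := rat_col_scale (col j0 K).
  have Ex : E *m x = 0.
    have : map_mx (intr : int -> rat) (E *m x) = 0.
      by rewrite map_mxM /= -ax -scalemxAr colE mulmxA mulmx_coker mul0mx scaler0.
    by move/matrixP => H0; apply/matrixP => i j; have /eqP := H0 i j; rewrite !mxE intr_eq0 => /eqP.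
  have w0 := HB (fun k => (comp_mx c ^+ k *m x) ord0 ord0) [seq (y - n0)%N | y <- ys].
  have x0 : x i0 ord0 = 0.
    have -> : x i0 ord0 = (comp_mx c ^+ i0 *m x) ord0 ord0.
      by rewrite -[in RHS](add0n i0) -window_of_iter expr0 mul1mx.
    apply: w0; first by move=> k; apply: iter_comp_mx_rec.
    - rewrite map_inj_in_uniq // => y1 y2 /ysI + /ysI; lia.
    - by rewrite size_map.
    move=> _ /mapP[y yys ->]; have ym : (index y ys < m)%N by rewrite index_mem.
    have /colP/(_ (Ordinal ym)) := Ex; rewrite !mxE => Ex0; rewrite -[RHS]Ex0.
    by apply: eq_bigr => j _; rewrite !mxE /yy /= nth_index.
  have /colP/(_ i0)/eqP := ax.
  by rewrite !mxE x0 mulf_eq0 intr_eq0 (negPf a0) => /eqP.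
pose f := fullrankfun full.
pose E' : 'M[int]_n.+1 := rowsub f E.
have E'b i j : `|E' i j| <= (L ^ H)%:R.
  by rewrite !mxE (le_trans (HL _ _ _)) // ler_nat leq_pexp2l.
have D0 : \det E' != 0.
  have := fullrowsub_full full; rewrite -map_mxsub -/f -/E' row_full_unit unitmxE unitfE.
  by rewrite det_map_mx intr_eq0.
(* One estimate serves for the determinant ([k = n.+1]) and for the minors in the adjugate
   ([k = n]). *)
have bnd k : (k <= n.+1)%N -> (k`!)%:R * ((L ^ H)%:R : int) ^+ k <= (C ^ H.+1)%:R.
  move=> kn; rewrite -natrX -natrM ler_nat expnSr /C.
  apply: leq_trans (_ : n.+1`! * (L ^ n.+1) ^ H <= _)%N.
    rewrite leq_mul ?fact_leq_homo //; first by rewrite dvdn_leq ?fact_gt0 // fact_dvdn_fact.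
    by rewrite -!expnM leq_pexp2l // mulnC leq_mul2r kn orbT.
  rewrite mulnC; apply: leq_mul; first by rewrite expnMn leq_pmull // expn_gt0 fact_gt0.
  by rewrite leq_pmulr // expn_gt0 L0.
exists (\det E'), (fun i l => (\adj E') i l), (fun l => yy (f l)); split => //.
- by apply: le_trans (norm_det_le E'b) _; apply: bnd.
- move=> i l; rewrite mxE /cofactor normrM normrX normrN1 expr1n mul1r.
  apply: le_trans (norm_det_le (b := (L ^ H)%:R) _) (bnd _ (leqnSn n)) => i' j'.
  by rewrite mxE [col' _ _ _ _]mxE E'b.
move=> i.
have E'u : E' *m window n u n0 = \col_l u (yy (f l)).
  apply/colP => l; have /ysI/andP[yn _] := yyin (f l).
  rewrite [RHS]mxE -[in RHS](subnKC yn) -[LHS]mul1r mul1r.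
  have -> : u (n0 + (yy (f l) - n0))%N = window n u (n0 + (yy (f l) - n0)) ord0 ord0.
    by rewrite mxE addn0.
  rewrite -(@comp_mx_window_iter n c u n0) // !mxE; apply: eq_bigr => j _.
  by rewrite !mxE.
have /colP/(_ i) : \adj E' *m (E' *m window n u n0) = \det E' *: window n u n0.
  by rewrite mulmxA mul_adj_mx mul_scalar_mx.
rewrite E'u !mxE => <-; by apply: eq_bigr => l _; rewrite !mxE.
Qed.

(** * Hankel determinants and growth *)

Definition hankel n (u : nat -> int) k : 'M[int]_n.+1 := \matrix_(i, j) u (k + i + j)%N.

(** The companion matrix shifts every column, so each step in [k] multiplies the determinant by its
    own, which is [c ord0] up to sign. *)
Lemma det_hankel n (c : 'I_n.+1 -> int) u k :
  (forall l, (1 <= l)%N -> u (l + n.+1)%N = \sum_(i < n.+1) c i * u (l + i)%N) ->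
  `|\det (hankel n u k.+1)| = `|c ord0| ^+ k * `|\det (hankel n u 1)|.
Proof.
move=> urec; elim: k => [|k IH]; first by rewrite expr0 mul1r.
have -> : hankel n u k.+2 = comp_mx c *m hankel n u k.+1.
  apply/matrixP => i j.
  have /colP/(_ i) : comp_mx c *m window n u (k.+1 + j) = window n u (k.+1 + j).+1.
    by apply: comp_mx_window; rewrite urec // addSn.
  rewrite !mxE -(_ : u (k.+2 + i + j)%N = u ((k.+1 + j).+1 + i)%N); last by congr u; lia.
  by move=> <-; apply: eq_bigr => l _; rewrite !mxE addnAC.
by rewrite det_mulmx normrM det_comp_mx IH exprS mulrA.
Qed.

Lemma coef_char_polynomial d (c : 'I_d -> int) i :
  (char_polynomial c)`_i = (i == d)%:R - (if insub i is Some j then c j else 0).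
Proof.
rewrite /char_polynomial coefB coefXn coef_sum; congr (_ - _).
case: insubP => [j _ <-|id].
  rewrite (bigD1 j) //= big1 => [|l lj]; rewrite coefZ coefXn.
    by rewrite eqxx mulr1 addr0.
  by rewrite (_ : (j == l :> nat) = false) ?mulr0 // eq_sym; apply/negbTE.
rewrite big1 // => l _; rewrite coefZ coefXn (_ : (i == l :> nat) = false) ?mulr0 //.
by apply/negbTE; apply: contraNneq id => ->.
Qed.

Lemma char_polynomial_coef0 n (c : 'I_n.+1 -> int) : (char_polynomial c)`_0 = - c ord0.
Proof.
rewrite coef_char_polynomial ltn_eqF // sub0r; congr (- _).
by case: insubP => // j _ j0; congr c; apply: val_inj.
Qed.

Lemma size_char_polynomial d (c : 'I_d -> int) : size (char_polynomial c) = d.+1.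
Proof.
rewrite /char_polynomial size_polyDl size_polyXn // size_polyN.
rewrite ltnS; apply: leq_trans (size_sum _ _ _) _; apply/bigmax_leqP => i _.
by rewrite (leq_trans (size_scale_leq _ _)) // size_polyXn.
Qed.

Lemma char_polynomial_monic d (c : 'I_d -> int) : char_polynomial c \is monic.
Proof.
rewrite monicE /lead_coef size_char_polynomial /= coef_char_polynomial eqxx.
by rewrite insubF ?ltnn // subr0.
Qed.

(** On windows the companion matrix acts as the shift, so a polynomial in it acts as the
    corresponding recurrence operator. *)
Lemma horner_mx_window (F : comNzRingType) n (c : 'I_n.+1 -> int) u (p : {poly F}) k (i : 'I_n.+1) :
  (forall l, (1 <= l)%N -> u (l + n.+1)%N = \sum_(i < n.+1) c i * u (l + i)%N) ->
  (1 <= k)%N ->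
  (horner_mx (map_mx intr (comp_mx c)) p *m map_mx intr (window n u k)) i ord0 =
  \sum_(j < size p) p`_j * (u (k + j + i)%N)%:~R.
Proof.
move=> urec k1; rewrite -[X in horner_mx _ X]coefK poly_def raddf_sum /= mulmx_suml summxE.
apply: eq_bigr => j _; rewrite horner_mxZ rmorphXn /= horner_mx_X -scalemxAl mxE; congr (_ * _).
by rewrite -rmorphXn /= -map_mxM (comp_mx_window_iter _ urec) // !mxE.
Qed.

Lemma horner_mx_char_window (F : comNzRingType) n (c : 'I_n.+1 -> int) u k :
  (forall l, (1 <= l)%N -> u (l + n.+1)%N = \sum_(i < n.+1) c i * u (l + i)%N) ->
  (1 <= k)%N ->
  horner_mx (map_mx intr (comp_mx c)) (map_poly intr (char_polynomial c))
    *m map_mx intr (window n u k) = 0 :> 'cV[F]_n.+1.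
Proof.
move=> urec k1; apply/colP => i; rewrite (horner_mx_window _ _ urec) // mxE.
rewrite size_map_poly_id0; last by rewrite (monicP (char_polynomial_monic c)) rmorph1 oner_neq0.
rewrite size_char_polynomial big_ord_recr /= coef_map /= coef_char_polynomial eqxx.
rewrite insubF ?ltnn // subr0 mul1r addnAC urec; last by rewrite ltn_addr.
rewrite rmorph_sum -big_split big1 //= => j _.
rewrite coef_map /= coef_char_polynomial ltn_eqF ?ltn_ord // valK sub0r rmorphM rmorphN /=.
by rewrite addnAC mulNr addNr.
Qed.

(* A singular Hankel matrix gives a shorter rational recurrence; the gcd of its
   polynomial with the characteristic polynomial is integral by Gauss's lemma. *)
Lemma det_hankel_neq0 n (u : nat -> int) (c : 'I_n.+2 -> int) :
  int_lrs_of_order u c -> \det (hankel n.+1 u 1) != 0.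
Proof.
move=> [_ urec umin]; apply/negP => /det0P[v v0 vH].
pose A : 'M[rat]_n.+2 := map_mx intr (comp_mx c).
pose W k : 'cV[rat]_n.+2 := map_mx intr (window n.+1 u k).
(* The entries of the kernel vector are the coefficients of a recurrence operator of degree below
   [n.+2] that annihilates the window at 1. *)
pose P : {poly rat} := \poly_(i < n.+2) (v ord0 (inord i))%:~R.
have P0 : P != 0.
  apply: contraNneq v0 => P0; apply/eqP/rowP => i; rewrite mxE; apply/eqP.
  have := coef_poly n.+2 (fun i => (v ord0 (inord i))%:~R : rat) i.
  by rewrite -/P P0 coef0 ltn_ord inord_val => /esym/eqP; rewrite intr_eq0.
have PW : horner_mx A P *m W 1%N = 0.
  apply/colP => i; rewrite /A /W (horner_mx_window _ _ urec) // mxE.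
  transitivity (\sum_(j < n.+2) P`_j * (u (1 + j + i)%N)%:~R).
    rewrite [RHS](bigID (fun j : 'I_n.+2 => (j < size P)%N)) /= [X in _ + X]big1 ?addr0.
      by rewrite -(big_ord_widen _ (fun j => P`_j * (u (1 + j + i)%N)%:~R)) // size_poly.
    by move=> j; rewrite -leqNgt => Pj; rewrite nth_default ?mul0r.
  have /rowP/(_ i) := vH; rewrite !mxE => /(congr1 (intr : int -> rat)).
  rewrite rmorph_sum /= => E; rewrite -[RHS]E; apply: eq_bigr => j _.
  by rewrite coef_poly ltn_ord inord_val mxE rmorphM.
pose f : {poly rat} := map_poly intr (char_polynomial c).
have fW : horner_mx A f *m W 1%N = 0 by apply: horner_mx_char_window.
(* By Bezout the gcd annihilates the window at 1 as well. *)
pose g := gcdp P f.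
have gW : horner_mx A g *m W 1%N = 0.
  have /eqpP[[a b] /= /andP[a0 b0] ab] := egcdpE P f.
  have -> : g = (a^-1 * b) *: ((egcdp P f).1 * P + (egcdp P f).2 * f).
    by rewrite -scalerA -ab scalerA mulVf // scale1r.
  rewrite horner_mxZ rmorphD !rmorphM /= -scalemxAl mulmxDl -!mulmxA PW fW.
  by rewrite !mulmx0 addr0 scaler0.
(* [g] is proportional to an integral [p1] that divides the monic characteristic polynomial over the
   integers, so the leading coefficient of [p1] is 1 or -1. *)
have [p1 [a a0 gp1] [r fr]] := dvdpP_rat_int (dvdp_gcdr P f).
have lp1 : lead_coef p1 * lead_coef p1 = 1.
  have : lead_coef p1 * lead_coef r = 1.
    by rewrite -lead_coefM -fr (monicP (char_polynomial_monic c)).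
  move: (lead_coef p1) (lead_coef r) => x y xy.
  have /eqP : (`|x| * `|y|)%N = 1%N by rewrite -abszM xy.
  by rewrite muln_eq1 => /andP[/eqP x1 _]; have [->|->] : x = 1 \/ x = -1 by lia.
have p10 : p1 != 0 by apply: contra_eqN lp1 => /eqP ->; rewrite lead_coef0 mul0r eq_sym oner_neq0.
have sp1 : (size p1 <= n.+2)%N.
  have -> : size p1 = size g.
    by rewrite /g gp1 size_scale // size_map_poly_id0 // intr_eq0 lead_coef_eq0.
  by apply: leq_trans (leq_gcdpl f P0) _; apply: size_poly.
have p1u k : (1 <= k)%N -> \sum_(j < size p1) p1`_j * u (k + j)%N = 0.
  move=> k1; apply/eqP; rewrite -(@intr_eq0 rat) rmorph_sum /=; apply/eqP.
  have : horner_mx A (map_poly intr p1) *m W k = 0.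
    have -> : W k = A ^+ k.-1 *m W 1%N.
      by rewrite /W /A -rmorphXn /= -map_mxM (comp_mx_window_iter _ urec) // add1n prednK.
    have -> : map_poly intr p1 = a^-1 *: g by rewrite /g gp1 scalerA mulVf // scale1r.
    rewrite mulmxA (_ : horner_mx A _ *m A ^+ k.-1 = A ^+ k.-1 *m horner_mx A (a^-1 *: g)).
      by rewrite -mulmxA horner_mxZ -scalemxAl gW scaler0 mulmx0.
    exact: (comm_horner_mx _ (commrX k.-1 (commr_refl A))).
  move/colP/(_ ord0); rewrite (horner_mx_window _ _ urec) // mxE.
  rewrite size_map_poly_id0 ?intr_eq0 ?lead_coef_eq0 // => E; rewrite -[RHS]E.
  by apply: eq_bigr => j _; rewrite rmorphM /= coef_map addn0.
have [e se] : exists e, size p1 = e.+1.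
  by exists (size p1).-1; rewrite prednK // size_poly_gt0.
(* A constant [p1] makes the sequence vanish identically; the zero recurrence of order 1 then
   contradicts minimality. *)
have [e0|e_gt0] := posnP e.
  apply: (umin 1%N (fun=> 0)) => // k k1; rewrite big1 => [|i _]; last by rewrite mul0r.
  have := p1u (k + 1)%N; rewrite se e0 big_ord_recr big_ord0 /= add0r addn0 addn1 => /(_ isT)/eqP.
  rewrite mulf_eq0 => /orP[/eqP p0|/eqP //].
  by move: lp1; rewrite /lead_coef se e0 /= p0 mul0r.
apply: (umin e (fun i => - (lead_coef p1 * p1`_i))); first by rewrite e_gt0 -ltnS -se.
move=> k k1; have := p1u k k1; rewrite se big_ord_recr /=.
have <- : lead_coef p1 = p1`_e by rewrite /lead_coef se.
move=> E; rewrite -[LHS]mul1r -lp1 -mulrA; move/eqP: E; rewrite addrC addr_eq0 => /eqP ->.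
rewrite mulrN mulr_sumr -sumrN; apply: eq_bigr => i _; by rewrite mulNr mulrA.
Qed.

Lemma char_polynomial_roots (R : rcfType) d (c : 'I_d -> int) :
  simple_poly R (char_polynomial c) ->
  exists2 z : 'I_d -> R[i], injective z &
    complex_poly R (char_polynomial c) = \prod_j ('X - (z j)%:P).
Proof.
move=> simp; set f := complex_poly R _.
have fm : f \is monic by rewrite /f /complex_poly monic_map ?char_polynomial_monic.
have [rs frs] := closed_field_poly_normal f.
rewrite (monicP fm) scale1r in frs.
have urs : uniq rs.
  apply/count_mem_uniq => z; have := simp z; rewrite -/f frs mu_prod_XsubC.
  by rewrite -has_pred1 has_count; case: (count_mem z rs) => [|[]].
have srs : size rs = d.
  have : size f = d.+1.
    rewrite /f /complex_poly size_map_poly_id0 ?size_char_polynomial //.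
    by rewrite (monicP (char_polynomial_monic c)) rmorph1 oner_neq0.
  by rewrite frs size_prod_XsubC => -[].
exists (fun j : 'I_d => rs`_j).
  by move=> i j /eqP; rewrite nth_uniq ?srs // => /eqP/val_inj.
by rewrite frs (big_nth 0) srs big_mkord.
Qed.

Lemma char_polynomial_rootE (R : rcfType) d (c : 'I_d -> int) (z : R[i]) :
  root (complex_poly R (char_polynomial c)) z -> z ^+ d = \sum_i (c i)%:~R * z ^+ i.
Proof.
move=> /rootP; rewrite /complex_poly /char_polynomial rmorphB /= rmorph_sum /= map_polyXn.
rewrite !hornerE horner_sum => /eqP; rewrite subr_eq0 => /eqP ->.
by apply: eq_bigr => i _; rewrite map_polyZ map_polyXn hornerZ hornerXn.
Qed.

(* Dividing the characteristic polynomial by [X - L], with [L] the dominant root,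
   gives a combination [V k] of [n.+2] consecutive terms which is geometric of
   ratio [L]. *)
Lemma lrs_growth (R : rcfType) n (u : nat -> int) (c : 'I_n.+2 -> int) :
  int_lrs_of_order u c -> simple_poly R (char_polynomial c) -> c ord0 != 0 ->
  has_dominant_root R (char_polynomial c) ->
  exists l b : R, [/\ 0 < l, 0 < b, `|c ord0|%:~R < l ^+ n.+2 &
    forall k, (1 <= k)%N -> b * l ^+ k <= \sum_(j < n.+2) `|u (k + j)%N|%:~R].
Proof.
move=> hu simp c0 [L Lroot Ldom].
have H0 := det_hankel_neq0 hu; have [_ urec _] := hu.
have [z zinj fz] := char_polynomial_roots simp.
set f := complex_poly R _ in fz Lroot Ldom.
have rootfE x : root f x = (x \in codom z).
  by rewrite fz -(big_map z predT (fun w => 'X - w%:P)) root_prod_XsubC /codom /image_mem enumT.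
have zroot j : root f (z j) by rewrite rootfE codom_f.
have [j0 Lz] : exists j, L = z j by move: Lroot; rewrite rootfE => /codomP.
have fE i : f`_i = (i == n.+2)%:R - (if insub i is Some j then (c j)%:~R else 0).
  rewrite /f /complex_poly coef_map /= coef_char_polynomial rmorphB /= rmorph_nat.
  by case: insub.
have zc : `|(c ord0)%:~R : R[i]| = \prod_j `|z j|.
  have : f.[0] = - (c ord0)%:~R.
    by rewrite horner_coef0 /f /complex_poly coef_map char_polynomial_coef0 /= intrN.
  rewrite fz horner_prod => /(congr1 Num.norm); rewrite normrN => <-.
  by rewrite normr_prod; apply: eq_bigr => j _; rewrite !hornerE ?sub0r ?add0r normrN.
have z0 j : z j != 0.
  apply: contraNneq c0 => zj0; move: zc; rewrite (bigD1 j) //= zj0 normr0 mul0r => /eqP.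
  by rewrite normr_eq0 intr_eq0.
have L0 : L != 0 by rewrite Lz z0.
(* [|c ord0|] is the product of the [n.+2] moduli of the roots, and at least one root differs from
   [L], hence is strictly smaller. *)
have cL : `|(c ord0)%:~R : R[i]| < `|L| ^+ n.+2.
  have [j1 j10] : exists j1, j1 != j0.
    exists (if j0 == ord0 then ord_max else ord0).
    by case: (eqVneq j0 ord0) => [->|]; rewrite // eq_sym.
  rewrite zc (bigD1 j1) //= exprS.
  have le : \prod_(i < n.+2 | i != j1) `|z i| <= `|L| ^+ n.+1.
    have cardj1 : n.+1 = #|[pred i : 'I_n.+2 | i != j1]|.
      by have := cardC1 j1; rewrite card_ord /= => E; rewrite -[LHS]E; apply: eq_card => i; rewrite !inE.
    rewrite [X in _ ^+ X]cardj1 -prodr_const; apply: ler_prod => i _; rewrite normr_ge0 /=.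
    have [->//|zL] := eqVneq (z i) L; exact/ltW/Ldom.
  apply: le_lt_trans (ler_wpM2l (normr_ge0 _) le) _.
  rewrite ltr_pM2r ?exprn_gt0 ?normr_gt0 // Ldom //.
  by rewrite Lz; apply: contra j10 => /eqP/zinj ->.
have sf : size f = n.+3 by rewrite fz -(big_map z predT (fun w => 'X - w%:P)) size_prod_XsubC size_map -[index_enum _]enumT size_enum_ord.
have [g fg] := factor_theorem f L Lroot.
have g0 : g != 0 by apply: contra_eqN sf => /eqP g0; rewrite fg g0 mul0r size_poly0.
have sg : size g = n.+2.
  by move: sf; rewrite fg size_Mmonic ?monicXsubC // size_XsubC addn2 => -[].
pose V k : R[i] := \sum_(j < n.+2) g`_j * (u (k + j)%N)%:~R.
have VS k : (1 <= k)%N -> V k.+1 = L * V k.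
  move=> k1; apply/eqP; rewrite -subr_eq0; apply/eqP.
  have -> : V k.+1 = \sum_(i < n.+3) (g * 'X)`_i * (u (k + i)%N)%:~R.
    rewrite [RHS]big_ord_recl coefMX eqxx mul0r add0r; apply: eq_bigr => i _.
    by rewrite coefMX /= /bump /= add1n addnS addSn.
  have -> : L * V k = \sum_(i < n.+3) (L * g`_i) * (u (k + i)%N)%:~R.
    rewrite [RHS]big_ord_recr /= [g`_n.+2]nth_default ?sg // mulr0 mul0r addr0.
    by rewrite mulr_sumr; apply: eq_bigr => i _; rewrite mulrA.
  rewrite -sumrB (eq_bigr (fun i : 'I_n.+3 => f`_i * (u (k + i)%N)%:~R)); last first.
    by move=> i _; rewrite -mulrBl fg mulrBr coefB coefMC [L * _]mulrC.
  rewrite big_ord_recr /= fE eqxx insubF ?ltnn // subr0 mul1r urec // rmorph_sum -big_split.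
  rewrite big1 //= => i _; rewrite fE ltn_eqF // valK sub0r rmorphM mulNr addNr //.
have Vk k : V k.+1 = L ^+ k * V 1%N.
  by elim: k => [|k IH]; rewrite ?expr0 ?mul1r // VS // IH exprS mulrA.
(* Otherwise every [V k] vanishes, and the coefficients of [g] form a kernel vector of the Hankel
   matrix. *)
have V1 : V 1%N != 0.
  apply: contra H0 => /eqP V10; rewrite -(@intr_eq0 R[i]) -det_map_mx; apply/det0P.
  exists (\row_j g`_j).
    apply: contra g0 => /eqP/rowP gz; apply/eqP/polyP => i; rewrite coef0.
    have [ni|ni] := leqP n.+2 i; first by rewrite nth_default ?sg.
    by have := gz (Ordinal ni); rewrite !mxE.
  have Vj j : V j.+1 = 0 by rewrite Vk V10 mulr0.
  apply/rowP => j; rewrite !mxE -[RHS](Vj j); apply: eq_bigr => i _.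
  by rewrite !mxE; congr (_ * (u _)%:~R); lia.
pose G := 1 + \sum_(j < n.+2) `|g`_j|.
have G0 : 0 < G by rewrite ltr_pwDl // sumr_ge0.
have VG k : `|V k| <= G * \sum_(j < n.+2) `|(u (k + j)%N)%:~R|.
  apply: le_trans (ler_norm_sum _ _ _) _; rewrite mulr_sumr; apply: ler_sum => j _.
  rewrite normrM ler_wpM2r // /G (bigD1 j) //= addrCA lerDl addr_ge0 // sumr_ge0 //.
(* The norm on [R[i]] takes values in [R[i]]; its real part is the modulus in [R]. *)
pose nm (x : R[i]) : R := complex.Re `|x|.
have nmE x : `|x| = (nm x)%:C%C by rewrite /nm normc_def.
have nm_gt0 x : x != 0 -> 0 < nm x by rewrite -normr_gt0 nmE ltcR.
have nmG : G = (nm G)%:C%C by rewrite -nmE gtr0_norm.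
(* The bound is [|L| ^ (k - 1) |V 1| = |V k| <= G] times the sum; the division by [nm L] makes up
   for the exponent [k - 1]. *)
exists (nm L), (nm (V 1%N) / (nm L * nm G)); split.
- exact: nm_gt0.
- by rewrite divr_gt0 ?mulr_gt0 ?nm_gt0 // gt_eqF.
- by rewrite -ltcR rmorph_int rmorphXn /= -nmE intr_norm.
case=> // k _; rewrite -lecR.
have -> : (nm (V 1%N) / (nm L * nm G) * nm L ^+ k.+1)%:C%C = `|V k.+1| / G.
  rewrite (Vk k) normrM normrX !nmE [in RHS]nmG -rmorphXn -rmorphM -fmorphV -rmorphM; congr (_%:C%C).
  have := nm_gt0 _ L0; have : 0 < nm G by rewrite nm_gt0 // gt_eqF.
  by move=> *; rewrite exprS; field; rewrite !gt_eqF.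
rewrite ler_pdivrMr // mulrC; apply: le_trans (VG _) _; rewrite ler_pM2l //.
rewrite rmorph_sum /=; apply: ler_sum => j _; by rewrite rmorph_int intr_norm.
Qed.

Lemma dvdz_rec n (c : 'I_n.+1 -> int) (u : nat -> int) (D m : int) n0 :
  (forall l, (n0 <= l)%N -> u (l + n.+1)%N = \sum_(i < n.+1) c i * u (l + i)%N) ->
  (forall i : 'I_n.+1, (m %| D * u (n0 + i)%N)%Z) ->
  forall i, (m %| D * u (n0 + i)%N)%Z.
Proof.
move=> urec Hm; elim/ltn_ind => i IH; have [ni|ni] := ltnP i n.+1.
  exact: (Hm (Ordinal ni)).
rewrite -(subnK ni) addnA urec ?leq_addr // mulr_sumr; apply: rpred_sum => j _.
by rewrite mulrCA dvdz_mull // -addnA IH //; have := ltn_ord j; lia.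
Qed.

(** By the Cramer relations, [m] divides [D] times the Hankel matrix at [n0] entrywise, and
    determinants give the power [n.+2]. The same relations bound the window at [n0] by the largest
    chosen term. *)
Lemma lrs_divisors_and_size (R : rcfType) n (u : nat -> int) (c : 'I_n.+2 -> int) :
  int_lrs_of_order u c -> simple_poly R (char_polynomial c) ->
  non_degenerate_poly R (char_polynomial c) ->
  exists B C Delta : nat, [/\ (0 < C)%N, (0 < Delta)%N &
    forall n0 H ys, (1 <= n0)%N -> uniq ys -> (B < size ys)%N ->
    (forall y, y \in ys -> n0 <= y <= n0 + H)%N ->
    (exists2 D, (0 < D <= C ^ H.+1)%N & forall m,
      (forall y, y \in ys -> m %| `|u y|)%N ->
      (m ^ n.+2 %| D ^ n.+2 * (`|c ord0| ^ n0.-1 * Delta))%N) /\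
    (exists2 y, y \in ys & forall i, (i < n.+2)%N ->
       (`|u (n0 + i)%N| <= n.+2 * C ^ H.+1 * `|u y|)%N)].
Proof.
move=> hu simp [f0 nondeg].
have H0 := det_hankel_neq0 hu; have [_ urec _] := hu.
have [z zinj fz] := char_polynomial_roots simp.
have c0 : c ord0 != 0 by move: f0; rewrite char_polynomial_coef0 oppr_eq0.
have zroot j : root (complex_poly R (char_polynomial c)) (z j).
  by rewrite fz /root horner_prod (bigD1 j) //= !hornerE subrr mul0r.
have zrec j := char_polynomial_rootE (zroot j).
have z0 j : z j != 0.
  apply: contraNneq c0 => zj0; have := zroot j; rewrite zj0 /root horner_coef0.
  by rewrite /complex_poly coef_map /= intr_eq0 char_polynomial_coef0 oppr_eq0.
have zT i j m : (0 < m)%N -> z i ^+ m = z j ^+ m -> i = j.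
  move=> m0 zij; apply/eqP; apply: contraT => ij.
  have zz : z i != z j by apply: contra ij => /eqP/zinj ->.
  case: (nondeg (z i) (z j) (zroot i) (zroot j) zz); exists m => //.
  by apply/unity_rootP; rewrite expr_div_n zij divff // expf_neq0.
have [B [C [C0 HB]]] := span_relations c0 zinj zrec zT.
exists B, C, `|\det (hankel n.+1 u 1)|%N; split; rewrite ?absz_gt0 //.
move=> n0 H ys n01 uys sys ysI.
have urec0 k : (n0 <= k)%N -> u (k + n.+2)%N = \sum_i c i * u (k + i)%N.
  by move=> n0k; apply: urec; apply: leq_trans n0k.
have [D [al [y [D0 DC yys alC Du]]]] := HB u n0 H ys urec0 uys sys ysI.
split.
  exists `|D|%N; first by rewrite absz_gt0 D0 /=; move: DC; lia.
  move=> m mys.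
  have mD i : (m%:Z %| D * u (n0 + i)%N)%Z.
    apply: (dvdz_rec urec0) => {}i; rewrite Du; apply: rpred_sum => l _.
    by rewrite dvdz_mull // dvdzE absz_nat mys.
  pose M : 'M[int]_n.+2 := \matrix_(i, j) ((D * u (n0 + i + j)%N) %/ m)%Z.
  have : D *: hankel n.+1 u n0 = m%:Z *: M.
    by apply/matrixP => i j; rewrite !mxE mulrC [RHS]mulrC divzK 1?mulrC // -addnA.
  move/(congr1 determinant); rewrite !detZ => /(congr1 absz).
  rewrite abszM [in RHS]abszM !abszX absz_nat => E; apply/dvdnP; exists `|\det M|%N.
  rewrite [RHS]mulnC -E; congr (_ * _)%N.
  have := det_hankel n0.-1 urec; rewrite prednK // -!abszE => /(congr1 absz).
  by rewrite absz_nat abszM abszX !absz_nat.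
have ys0 : exists2 y0, y0 \in ys & forall y1, y1 \in ys -> (`|u y1| <= `|u y0|)%N.
  have /hasP[y0 y0s _] : has predT ys by rewrite has_predT; apply: leq_trans sys.
  have y0lt : (index y0 ys < size ys)%N by rewrite index_mem.
  case: (arg_maxnP (fun i : 'I_(size ys) => `|u (nth 0%N ys i)|%N) (isT : xpredT (Ordinal y0lt))).
  move=> i _ imax; exists (nth 0%N ys i); first by rewrite mem_nth.
  move=> y1 y1s; have y1lt : (index y1 ys < size ys)%N by rewrite index_mem.
  by have := imax (Ordinal y1lt) isT; rewrite /= nth_index.
have [y0 y0s y0max] := ys0; exists y0 => // i ni.
have /(congr1 Num.norm) := Du (Ordinal ni); rewrite normrM /= => E.
have : `|u (n0 + i)%N| <= n.+2%:R * ((C ^ H.+1)%:R * `|u y0|).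
  apply: (@le_trans _ _ (`|D| * `|u (n0 + i)%N|)).
    by rewrite ler_peMl // -gtz0_ge1 normr_gt0.
  rewrite E mulr_natl -[X in _ *+ X](card_ord n.+2) -sumr_const.
  apply: le_trans (ler_norm_sum _ _ _) _; apply: ler_sum => l _.
  by rewrite normrM ler_pM //; have := y0max _ (yys l); lia.
by rewrite -!abszE mulrA !natz -!PoszM lez_nat.
Qed.

(** * Terms with a large part prime to c_0 *)

Local Close Scope ring_scope.

(* The two consequences of [span_relations] for [U y = |u y|]: a bound for the
   common divisors of more than [B] terms taken in a short interval, coming from
   the Hankel determinant [c0 ^ n0.-1 * Delta], and the fact that these terms are
   not all small. *)
Definition lrs_core (d c0 B C Delta : nat) (U : nat -> nat) : Prop :=
  forall n0 H ys, (1 <= n0)%N -> uniq ys -> (B < size ys)%N ->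
  (forall y, y \in ys -> n0 <= y <= n0 + H)%N ->
  (exists2 D, (0 < D <= C ^ H.+1)%N & forall m,
    (forall y, y \in ys -> m %| U y)%N ->
    (m ^ d %| D ^ d * (c0 ^ n0.-1 * Delta))%N) /\
  (exists2 y, y \in ys & forall i, (i < d)%N ->
     (U (n0 + i) <= d * C ^ H.+1 * U y)%N).

Lemma seq_argmin (T : eqType) (f : T -> nat) (ys : seq T) : (0 < size ys)%N ->
  exists2 y, y \in ys & forall y', y' \in ys -> (f y <= f y')%N.
Proof.
elim: ys => // a [|b ys] IH _.
  by exists a; rewrite ?mem_head // => y'; rewrite inE => /eqP->.
have [//|y ys_y ymin] := IH.
have [fay|fya] := leqP (f a) (f y).
  exists a; rewrite ?mem_head // => y'; rewrite inE => /predU1P[->//|/ymin].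
  exact: leq_trans.
exists y; first by rewrite inE ys_y orbT.
by move=> y'; rewrite inE => /predU1P[->|/ymin //]; apply: ltnW.
Qed.

Lemma size_cover (T : Type) (I : eqType) (ys : seq T) (Is : seq I) (P : I -> pred T) :
  all (fun y => has (fun i => P i y) Is) ys ->
  (size ys <= \sum_(i <- Is) count (P i) ys)%N.
Proof.
elim: ys => [|y ys IH] //= /andP[hy /IH le].
rewrite big_split /= -add1n leq_add // {le IH}.
elim: Is hy => //= i Is IH; rewrite big_cons => /orP[->//|/IH].
by move=> le; rewrite (leq_trans le) // leq_addl.
Qed.

Lemma partn_primes c n : n`_(\pi(c)) = (\prod_(p <- primes c) p ^ logn p n)%N.
Proof.
rewrite (@widen_partn (maxn c n)) ?leq_maxr // -[LHS]big_filter; apply: perm_big.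
apply: uniq_perm; rewrite ?filter_uniq ?iota_uniq ?primes_uniq // => p.
rewrite mem_filter mem_index_iota leq0n /= ltnS /=.
apply/andP/idP => [[]//|pc]; split => //.
by move: pc; rewrite mem_primes => /and3P[_ c0 /dvdn_leq]; rewrite leq_max => -> //.
Qed.

(** Among more than [B] such terms, [p] to the least valuation is a common divisor, which would
    violate the bound of [lrs_core]. *)
Lemma padic_exceptions d c0 B C Delta U p n0 H ys :
  lrs_core d c0 B C Delta U -> (0 < C)%N -> (0 < c0)%N -> (0 < Delta)%N ->
  prime p -> (1 <= n0)%N -> uniq ys ->
  (forall y, y \in ys -> n0 <= y <= n0 + H)%N ->
  (count (fun y => (C ^ H.+1) ^ d * p ^ logn p (c0 ^ n0.-1 * Delta) < p ^ (logn p (U y) * d)) ys <= B)%N.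
Proof.
move=> core C0 c00 Delta0 p_pr n01 uys ysI; set X := (c0 ^ _ * _)%N.
have X0 : (0 < X)%N by rewrite muln_gt0 expn_gt0 c00.
rewrite leqNgt; apply/negP; rewrite -size_filter; set zs := seq.filter _ _ => szs.
have [|[D /andP[D0 DC] Ddvd] _] := core n0 H zs n01 (filter_uniq _ uys) szs.
  by move=> y; rewrite mem_filter => /andP[_ /ysI].
have [|y0 y0zs y0min] := seq_argmin (fun y => logn p (U y)) (ys := zs).
  exact: leq_trans szs.
have : (p ^ logn p (U y0)) ^ d %| D ^ d * X.
  apply: Ddvd => y yzs; apply: dvdn_trans (pfactor_dvdnn p _).
  by apply: dvdn_exp2l; apply: y0min.
have DX0 : (0 < D ^ d)%N by rewrite expn_gt0 D0.
rewrite -expnM pfactor_dvdn ?(muln_gt0 (D ^ d)) ?DX0 ?X0 //.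
rewrite lognM ?X0 // lognX => le.
move: y0zs; rewrite mem_filter => /andP[]; rewrite ltnNge => /negP[].
apply: leq_trans (_ : p ^ (d * logn p D + logn p X) <= _)%N.
  by rewrite leq_pexp2l // prime_gt0.
rewrite expnD leq_mul2r; apply/orP; right; rewrite mulnC expnM.
have : (p ^ logn p D <= C ^ H.+1)%N.
  by apply: leq_trans DC; rewrite dvdn_leq // pfactor_dvdnn.
have [->|d0] := posnP d; first by rewrite !expn0.
by rewrite leq_exp2r.
Qed.

(** Each of the conditions, one on size ([None]) and one for each prime of [c0] ([Some p]), fails
    for at most [B] terms. The local bounds multiply to a bound for the whole part at these
    primes. *)
Lemma good_term_exists d c0 B C Delta U n0 H ys :
  lrs_core d c0 B C Delta U -> (0 < C)%N -> (0 < c0)%N -> (0 < Delta)%N ->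
  (1 <= n0)%N -> uniq ys -> (forall y, y \in ys -> n0 <= y <= n0 + H)%N ->
  (B * (size (primes c0)).+1 < size ys)%N ->
  exists2 y, y \in ys &
    (forall i, (i < d)%N -> (U (n0 + i) <= d * C ^ H.+1 * U y)%N) /\
    (((U y)`_(\pi(c0))) ^ d <= ((C ^ H.+1) ^ d) ^ size (primes c0) * (c0 ^ n0.-1 * Delta))%N.
Proof.
move=> core C0 c00 Delta0 n01 uys ysI sys; set X := (c0 ^ _ * _)%N.
have X0 : (0 < X)%N by rewrite muln_gt0 expn_gt0 c00.
pose P (o : option nat) y := if o is Some p then
   ((C ^ H.+1) ^ d * p ^ logn p X < p ^ (logn p (U y) * d))%N
   else ~~ [forall i : 'I_d, U (n0 + i) <= d * C ^ H.+1 * U y]%N.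
pose Is := None :: [seq Some p | p <- primes c0].
have : ~~ all (fun y => has (P^~ y) Is) ys.
  apply: contraL sys => /size_cover le; rewrite -leqNgt (leq_trans le) //.
  rewrite big_cons mulnS leq_add //.
    rewrite leqNgt -size_filter; apply/negP => szs.
    have [|_ [y yzs yU]] := core n0 H _ n01 (filter_uniq _ uys) szs.
      by move=> y; rewrite mem_filter => /andP[_ /ysI].
    move: yzs; rewrite mem_filter => /andP[/negP[]] //.
    by apply/forallP => i; apply: yU.
  rewrite big_map -[X in (_ <= B * X)%N]sum1_size big_distrr /= muln1.
  rewrite big_seq [X in (_ <= X)%N]big_seq; apply: leq_sum => p.
  rewrite mem_primes => /and3P[p_pr _ _]; exact: padic_exceptions.
case/allPn => y yys /hasPn nP; exists y => //; split.
  have := nP None (mem_head _ _); rewrite negbK => /forallP yP i id.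
  exact: (yP (Ordinal id)).
have /(dvdn_leq X0) le : X`_(\pi(c0)) %| X by apply: dvdn_part.
apply: leq_trans (_ : ((C ^ H.+1) ^ d) ^ size (primes c0) * X`_(\pi(c0)) <= _)%N; last first.
  by rewrite leq_mul2l le orbT.
rewrite !partn_primes -[size _]sum1_size expn_sum -big_split.
rewrite (big_morph (fun m => m ^ d)%N (fun a b => expnMn a b d) (exp1n d)).
rewrite big_seq [X in (_ <= X)%N]big_seq; apply: leq_prod => p pc /=.
rewrite expn1 -expnM leqNgt; apply: (nP (Some p)).
by rewrite inE /= map_f.
Qed.

(** * Common divisors of several terms *)

Lemma dvdn_of_logn m n : (0 < m)%N -> (0 < n)%N ->
  (forall p, prime p -> (logn p m <= logn p n)%N) -> m %| n.
Proof.
move=> m0 n0 H; apply/(dvdn_partP _ m0) => p; rewrite mem_primes => /and3P[p_pr _ _].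
by rewrite p_part pfactor_dvdn // H.
Qed.

Lemma logn_prod (I : finType) (P : pred I) (F : I -> nat) p :
  (forall i, P i -> 0 < F i)%N ->
  logn p (\prod_(i | P i) F i) = (\sum_(i | P i) logn p (F i))%N.
Proof.
move=> F0; suff [] : (0 < \prod_(i | P i) F i)%N /\
   logn p (\prod_(i | P i) F i) = (\sum_(i | P i) logn p (F i))%N by [].
elim/big_rec2: _ => [|i a b Pi [b0 <-]]; first by rewrite logn1.
by rewrite muln_gt0 b0 F0 // lognM ?F0.
Qed.

(** For each prime, let [t] be the largest threshold that more than [B] of the valuations reach. At
    most [B] indices exceed [t], and they cost [Q ^ B]; some [B.+1] indices reach [t], so their gcd
    has valuation at least [t]. *)
Lemma gcd_pigeonhole (Q B K : nat) (g : 'I_K -> nat) :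
  (0 < Q)%N -> (B < K)%N -> (forall i, g i %| Q) ->
  \prod_i g i %|
    Q ^ B * (\prod_(Y : {set 'I_K} | #|Y| == B.+1) \big[gcdn/0]_(i in Y) g i) ^ K.
Proof.
move=> Q0 BK gQ; have g0 i : (0 < g i)%N by apply: dvdn_gt0 (gQ i).
pose G (Y : {set 'I_K}) := \big[gcdn/0]_(i in Y) g i.
have G0 (Y : {set 'I_K}) : #|Y| == B.+1 -> (0 < G Y)%N.
  move=> cY; have /card_gt0P[i iY] : (0 < #|Y|)%N by rewrite (eqP cY).
  by apply: dvdn_gt0 (g0 i) _; rewrite /G (bigD1 i) //= dvdn_gcdl.
have prodG0 : (0 < \prod_(Y : {set 'I_K} | #|Y| == B.+1) G Y)%N by apply: prodn_cond_gt0.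
apply: dvdn_of_logn => [||p p_pr]; first exact: prodn_gt0.
  by rewrite muln_gt0 !expn_gt0 Q0 prodG0.
rewrite lognM ?expn_gt0 ?Q0 ?prodG0 // !lognX !logn_prod //.
pose v i := logn p (g i); rewrite -/(v _).
have vQ i : (v i <= logn p Q)%N by apply: dvdn_leq_log.
pose S t : {set 'I_K} := [set i | t <= v i].
pose P t := (B < #|S t|)%N.
have P0 : exists t, P t by exists 0%N; rewrite /P /S cardsE card_ord.
have Pmax t : P t -> (t <= logn p Q)%N.
  move=> Pt; have St : (0 < #|S t|)%N by apply: leq_trans Pt.
  have [i Si] := elimT card_gt0P St.
  by move: Si; rewrite inE => /leq_trans->.
have [t Pt tmax] := ex_maxnP P0 Pmax.
have cS : (#|S t.+1| <= B)%N.
  by rewrite leqNgt; apply/negP => /tmax; rewrite ltnn.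
have tG : (t <= \sum_(Y : {set 'I_K} | #|Y| == B.+1) logn p (G Y))%N.
  pose Y := [set i in take B.+1 (enum (S t))].
  have cY : #|Y| == B.+1.
    have us : uniq (take B.+1 (enum (S t))) by rewrite take_uniq ?enum_uniq.
    by rewrite cardsE (card_uniqP us) size_takel // -cardE.
  rewrite (bigD1 Y) //= (leq_trans _ (leq_addr _ _)) // -pfactor_dvdn ?G0 //.
  apply/dvdn_biggcdP => i; rewrite inE => /mem_take; rewrite mem_enum inE => tv.
  by rewrite pfactor_dvdn.
apply: leq_trans (_ : B * logn p Q + K * t <= _)%N; last by rewrite leq_add2l leq_mul2l tG orbT.
apply: leq_trans (_ : \sum_(i < K) (t + (t < v i) * logn p Q) <= _)%N.
  apply: leq_sum => i _; case: ltnP => [tv|]; last by rewrite mul0n addn0.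
  by rewrite mul1n (leq_trans (vQ i)) ?leq_addl.
rewrite big_split /= sum_nat_const card_ord addnC leq_add2r -big_distrl leq_mul2r /=.
by rewrite /S -sum1dep_card big_mkcond /= in cS; apply/orP; right; apply: leq_trans cS; apply: leq_sum => i _; case: ltnP.
Qed.

Definition coprime_part (c0 n : nat) : nat := n`_(\pi(c0)^').

Lemma coprime_part_pnat c0 n m : m %| coprime_part c0 n -> (0 < c0)%N -> coprime m c0.
Proof.
move=> mq c00; have m0 : (0 < m)%N by apply: dvdn_gt0 mq; apply: part_gt0.
by rewrite coprime_sym coprime_pi' // (pnat_dvd mq) // part_pnat.
Qed.

(** Over [K = s * B + 1] indices, [Q ^ K] is at most the [s]-th power of the product of the gcds,
    itself at most [Q ^ B * G ^ K]. Cancelling [Q ^ (s * B)] leaves a single [Q] against a power of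
    [W]. *)
Lemma many_common_divisors d c0 B C Delta U s a n0 H ys :
  lrs_core d c0 B C Delta U -> (0 < d)%N -> (0 < C)%N -> (0 < c0)%N -> (0 < Delta)%N ->
  (0 < s)%N -> (1 <= n0)%N -> uniq ys -> (forall y, y \in ys -> n0 <= y <= n0 + H)%N ->
  (forall y, y \in ys ->
     coprime_part c0 (U a) <= gcdn (coprime_part c0 (U a)) (coprime_part c0 (U y)) ^ s)%N ->
  (s * B < size ys)%N ->
  (coprime_part c0 (U a) <= (C ^ H.+1 * Delta) ^ (2 ^ (s * B).+1 * (s * B).+1 * s))%N.
Proof.
move=> core d0 C0 c00 Delta0 s0 n01 uys ysI ysg sys; set Q := coprime_part c0 (U a) in ysg *.
set K := (s * B).+1; set W := (C ^ H.+1 * Delta)%N.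
have W0 : (0 < W)%N by rewrite muln_gt0 expn_gt0 C0.
pose y (i : 'I_K) := nth 0%N ys i.
have yys i : y i \in ys by apply: mem_nth; apply: leq_trans (ltn_ord i) _.
have yinj : injective y.
  move=> i j /eqP; rewrite nth_uniq //; try by apply: leq_trans (ltn_ord _) _.
  by move=> /eqP/val_inj.
have Q0 : (0 < Q)%N by apply: part_gt0.
pose g i := gcdn Q (coprime_part c0 (U (y i))).
have BK : (B < K)%N by rewrite ltnS leq_pmull.
pose G := (\prod_(Y : {set 'I_K} | #|Y| == B.+1) \big[gcdn/0]_(i in Y) g i)%N.
have gdvd : \prod_i g i %| Q ^ B * G ^ K.
  by apply: gcd_pigeonhole => // i; apply: dvdn_gcdl.
have GW : (0 < G <= W ^ (2 ^ K))%N.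
  have GY (Y : {set 'I_K}) : #|Y| == B.+1 -> (0 < \big[gcdn/0]_(i in Y) g i <= W)%N.
    move=> cY; set GY := \big[_/_]_(_ in _) _.
    have GYg i : i \in Y -> GY %| g i by move=> iY; rewrite /GY (bigD1 i) //= dvdn_gcdl.
    have [i iY] : exists i, i \in Y by apply/card_gt0P; rewrite (eqP cY).
    have GYQ : GY %| Q by apply: dvdn_trans (GYg i iY) (dvdn_gcdl _ _).
    have GY0 : (0 < GY)%N by apply: dvdn_gt0 GYQ.
    rewrite GY0 /=; pose zs := [seq y i | i <- enum Y].
    have [|||[D /andP[D0 DC] Ddvd] _] := core n0 H zs n01.
    - by rewrite map_inj_uniq ?enum_uniq.
    - by rewrite size_map -cardE (eqP cY).
    - by move=> _ /mapP[j _ ->]; apply: ysI.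
    have /Ddvd : forall z, z \in zs -> GY %| U z.
      move=> _ /mapP[j + ->]; rewrite mem_enum => /GYg/dvdn_trans; apply.
      exact: dvdn_trans (dvdn_gcdr _ _) (dvdn_part _ _).
    (* The common divisor is prime to [c0], so the factor [c0 ^ n0.-1], the only one that grows with
       [n0], drops out. *)
    have cop : coprime (GY ^ d) (c0 ^ n0.-1).
      by rewrite coprimeXl // coprimeXr // (coprime_part_pnat GYQ).
    rewrite mulnCA Gauss_dvdr // => /dvdn_leq; rewrite muln_gt0 expn_gt0 D0 Delta0 => /(_ isT) le.
    rewrite -(leq_exp2r _ _ d0) (leq_trans le) // /W expnMn leq_mul //.
      by rewrite leq_exp2r.
    by rewrite -{1}(expn1 Delta) leq_pexp2l.
  apply/andP; split; first by apply: prodn_cond_gt0 => Y cY; case/andP: (GY Y cY).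
  apply: leq_trans (_ : \prod_(Y : {set 'I_K} | #|Y| == B.+1) W <= _)%N.
    by apply: leq_prod => Y cY; case/andP: (GY Y cY).
  rewrite prod_nat_const leq_pexp2l // -[in X in (_ <= 2 ^ X)%N](card_ord K) -cardsT -card_powerset.
  by apply: subset_leq_card; apply/fintype.subsetP => Y _; rewrite inE finset.subsetT.
case/andP: GW => G0 GW.
have {gdvd} le1 : (\prod_i g i <= Q ^ B * G ^ K)%N by rewrite dvdn_leq // muln_gt0 !expn_gt0 Q0 G0.
have le2 : (Q ^ K <= (\prod_i g i) ^ s)%N.
  rewrite (big_morph (fun m => m ^ s)%N (fun a b => expnMn a b s) (exp1n s)).
  by rewrite -[X in (_ ^ X)%N]card_ord -prod_nat_const; apply: leq_prod => i _; apply: ysg.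
have le3 : (Q * Q ^ (s * B) <= W ^ (2 ^ K * K * s) * Q ^ (s * B))%N.
  rewrite -expnS (leq_trans le2) // (leq_trans (_ : _ <= (Q ^ B * G ^ K) ^ s)%N) ?leq_exp2r //.
  rewrite expnMn mulnC -!expnM [(s * B)%N]mulnC leq_mul2r; apply/orP; right.
  by rewrite [in X in (_ <= X)%N]expnM [in X in (_ <= X)%N]expnM [in X in (X <= _)%N]expnM leq_exp2r // leq_exp2r.
by rewrite leq_pmul2r ?expn_gt0 ?Q0 // in le3.
Qed.

(** * Logarithmic estimates on short intervals *)

Local Open Scope ring_scope.

Lemma ler_ln_nat (R : realType) m n : (0 < m)%N -> (m <= n)%N -> ln (m%:R : R) <= ln n%:R.
Proof. by move=> m0 mn; rewrite ler_ln ?posrE ?ltr0n ?ler_nat // (leq_trans m0). Qed.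

Lemma ln_natM (R : realType) m n : (0 < m)%N -> (0 < n)%N ->
  ln ((m * n)%:R : R) = ln m%:R + ln n%:R.
Proof. by move=> m0 n0; rewrite natrM lnM ?posrE ?ltr0n. Qed.

Lemma ln_natX (R : realType) m k : (0 < m)%N ->
  ln ((m ^ k)%:R : R) = k%:R * ln m%:R.
Proof. by move=> m0; rewrite natrX lnXn ?ltr0n // mulr_natl. Qed.

Lemma ln_nat_ge0 (R : realType) m : 0 <= ln (m%:R : R).
Proof. by case: m => [|m]; [rewrite ln0|rewrite ln_ge0 // ler1n]. Qed.

Lemma size_interval n0 H ys : uniq ys ->
  (forall y, y \in ys -> n0 <= y <= n0 + H)%N -> (size ys <= H.+1)%N.
Proof.
move=> uys ysI; rewrite -(size_iota n0 H.+1); apply: uniq_leq_size => // y /ysI.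
by rewrite mem_iota addnS ltnS.
Qed.

(** [h] is chosen so that the term in [A1] takes at most half of [n%:R * k], and [N] so that [A2]
    takes at most the other half. *)
Lemma small_scale_absorbs (R : realType) (k A1 A2 : R) : 0 < k -> 0 <= A1 ->
  exists h N : nat, (0 < h)%N /\ forall n, (N < n)%N ->
    A2 + (n %/ h)%:R * A1 <= n%:R * k.
Proof.
move=> k0 A10; pose h := (Num.bound (2 * A1 / k)).+1.
exists h, (Num.bound (2 * `|A2| / k)); split=> // n nN.
have h1 : 2 * A1 <= h%:R * k.
  have b1 : 2 * A1 / k < (Num.bound (2 * A1 / k))%:R.
    by apply: archi_boundP; rewrite divr_ge0 ?mulr_ge0 // ltW.
  by rewrite -ler_pdivrMr // (le_trans (ltW b1)) // ler_nat.
have n1 : 2 * `|A2| <= n%:R * k.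
  have b1 : 2 * `|A2| / k < (Num.bound (2 * `|A2| / k))%:R.
    by apply: archi_boundP; rewrite divr_ge0 ?mulr_ge0 // ltW.
  by rewrite -ler_pdivrMr // (le_trans (ltW b1)) // ler_nat ltnW.
have n2 : (n %/ h)%:R * h%:R <= n%:R :> R by rewrite -natrM ler_nat leq_divM.
have q0 : 0 <= (n %/ h)%:R :> R by [].
have := ler_norm A2.
have : (n %/ h)%:R * (2 * A1) <= n%:R * k.
  by apply: le_trans (ler_wpM2l q0 h1) _; rewrite mulrA ler_wpM2r // ltW.
lra.
Qed.

(* All but boundedly many [y] of the interval escape the exceptional sets of
   [good_term_exists]; for these the part of [U y] made of primes dividing [c0] is
   about [c0 ^ (y / d)] at most, while [U y] is about [l ^ y] at least. *)
Lemma few_bad_terms (R : realType) d c0 B C Delta U (l b : R) :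
  lrs_core d c0 B C Delta U -> (0 < d)%N -> (0 < C)%N -> (0 < c0)%N -> (0 < Delta)%N ->
  0 < l -> 0 < b -> c0%:R < l ^+ d ->
  (forall k, (1 <= k)%N -> b * l ^+ k <= \sum_(j < d) (U (k + j)%N)%:R) ->
  exists delta : R, 0 < delta /\ exists K h, (0 < h)%N /\ forall n0 ys, (1 <= n0)%N ->
    uniq ys -> (forall y, y \in ys -> n0 <= y <= n0 + n0 %/ h)%N ->
    (forall y, y \in ys -> U y = 0%N \/ ln (coprime_part c0 (U y))%:R < delta * y%:R) ->
    (size ys <= K)%N.
Proof.
move=> core d0 C0 c00 Delta0 l0 b0 cl growth.
(* The gain in [d * ln (U y)] per unit of [n0] over the part supported at the primes of [c0]; it is
   positive since [c0 < l ^ d]. *)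
pose k := d%:R * ln l - ln c0%:R.
have k0 : 0 < k.
  by rewrite subr_gt0 mulr_natl -lnXn // ltr_ln ?posrE ?ltr0n ?exprn_gt0.
have dR : 0 < d%:R :> R by rewrite ltr0n.
pose w : R := (size (primes c0))%:R.
pose A1 := d%:R * (1 + w) * ln (C%:R : R).
have A10 : 0 <= A1 by rewrite !mulr_ge0 ?ln_nat_ge0 ?addr_ge0 // ler0n.
pose A2 := A1 + ln (Delta%:R : R) + 2 * d%:R * ln d%:R - d%:R * ln b.
have [|h [N [h0 absorb]]] := @small_scale_absorbs R (k / 2) A1 A2 _ A10; first by lra.
(* The errors use up half of [k], [y <= 2 * n0] costs another factor 2, and [d] comes from the
   [d]-th powers in [good_term_exists]. *)
exists (k / (4 * d%:R)); split; first by rewrite divr_gt0 ?mulr_gt0.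
exists (maxn N.+1 (B * (size (primes c0)).+1)), h; split=> // n0 ys n01 uys ysI bad.
have [n0N|Nn0] := leqP n0 N.
  rewrite leq_max (leq_trans (size_interval uys ysI)) // ltnS.
  by rewrite (leq_trans _ n0N) // leq_div.
rewrite leqNgt; apply/negP; rewrite gtn_max => /andP[_ sys].
have [y yys [yU ysig]] := good_term_exists core C0 c00 Delta0 n01 uys ysI sys.
set H := (n0 %/ h)%N in ysI yU ysig.
set M := (d * (d * C ^ H.+1 * U y))%N.
have leM : b * l ^+ n0 <= M%:R.
  apply: le_trans (growth _ n01) _; rewrite -natr_sum ler_nat /M.
  by rewrite -[X in (_ <= X * _)%N]card_ord -sum_nat_const; apply: leq_sum => i _; apply: yU.
have M0 : (0 < M)%N by rewrite -(ltr0n R) (lt_le_trans _ leM) // mulr_gt0 ?exprn_gt0.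
have Uy0 : (0 < U y)%N by move: M0; rewrite /M !muln_gt0 => /andP[_ /andP[_ ->]].
case: (bad y yys) => [Uy|]; first by rewrite Uy in Uy0.
set q := coprime_part _ _; set sg := (_`_ _)%N in ysig.
have Uq : U y = (sg * q)%N by rewrite /sg /q /coprime_part partnC.
have q0 : (0 < q)%N by apply: part_gt0.
have sg0 : (0 < sg)%N by apply: part_gt0.
have CH : (0 < C ^ H.+1)%N by rewrite expn_gt0 C0.
have ln1 : ln b + n0%:R * ln l <= 2 * ln d%:R + H.+1%:R * ln C%:R + ln sg%:R + ln q%:R.
  have -> : ln b + n0%:R * ln l = ln (b * l ^+ n0).
    by rewrite lnM ?posrE ?exprn_gt0 // lnXn // mulr_natl.
  have -> : 2 * ln d%:R + H.+1%:R * ln C%:R + ln sg%:R + ln q%:R = ln (M%:R : R).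
    rewrite /M Uq !ln_natM ?muln_gt0 ?d0 ?CH ?sg0 ?q0 // ln_natX //; lra.
  by rewrite ler_ln ?posrE ?mulr_gt0 ?exprn_gt0 // ltr0n.
have ln2 : d%:R * ln (sg%:R : R) <= w * (d%:R * (H.+1%:R * ln C%:R)) + n0%:R * ln c0%:R + ln Delta%:R.
  rewrite -ln_natX //; apply: le_trans (ler_ln_nat _ _ ysig) _; first by rewrite expn_gt0 sg0.
  rewrite !ln_natM ?muln_gt0 ?expn_gt0 ?C0 ?c00 ?CH // !ln_natX ?expn_gt0 ?C0 ?CH //.
  rewrite addrA lerD2r lerD2l ler_wpM2r ?ln_nat_ge0 // ler_nat leq_pred //.
have := absorb n0 Nn0; rewrite -/H.
have Hs : H.+1%:R = H%:R + 1 :> R by rewrite natr1.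
have y2 : y%:R <= 2 * n0%:R :> R.
  rewrite -natrM ler_nat mul2n -addnn; have /andP[_ /leq_trans->//] := ysI y yys.
  by rewrite leq_add2l leq_div.
move=> abs; rewrite ltNge => /negP; apply.
rewrite mulrAC ler_pdivrMr ?mulr_gt0 //.
have ky : k * y%:R <= k * (2 * n0%:R) by rewrite ler_wpM2l // ltW.
apply: le_trans ky _.
have := ler_wpM2l (ltW dR) ln1; rewrite Hs in ln2 *.
rewrite /A2 /A1 /k in abs *; nra.
Qed.

(** More partners would bound [ln q] by [O(a / h + 1)], below [delta * a] once [h] and [a] are
    large. Only the length of the interval is tied to [a]; its position [n0] is free. *)
Lemma few_partners (R : realType) d c0 B C Delta U s (delta : R) :
  lrs_core d c0 B C Delta U -> (0 < d)%N -> (0 < C)%N -> (0 < c0)%N -> (0 < Delta)%N ->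
  (0 < s)%N -> 0 < delta ->
  exists K h, (0 < h)%N /\ forall a n0 ys, (1 <= n0)%N ->
    delta * a%:R <= ln (coprime_part c0 (U a))%:R ->
    uniq ys -> (forall y, y \in ys -> n0 <= y <= n0 + a %/ h)%N ->
    (forall y, y \in ys ->
     coprime_part c0 (U a) <= gcdn (coprime_part c0 (U a)) (coprime_part c0 (U y)) ^ s)%N ->
    (size ys <= K)%N.
Proof.
move=> core d0 C0 c00 Delta0 s0 delta0.
pose E : R := (2 ^ (s * B).+1 * (s * B).+1 * s)%:R.
have E0 : 0 <= E by rewrite ler0n.
have EC0 : 0 <= E * ln C%:R by rewrite mulr_ge0 ?ln_nat_ge0.
have [|h [N [h0 absorb]]] := @small_scale_absorbs R (delta / 2) (E * ln C%:R)
  (E * (ln C%:R + ln Delta%:R) ) _ EC0; first by lra.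
exists (maxn N.+1 (s * B)), h; split=> // a n0 ys n01 ga uys ysI ysg.
have [aN|Na] := leqP a N.
  rewrite leq_max (leq_trans (size_interval uys ysI)) // ltnS.
  by rewrite (leq_trans _ aN) // leq_div.
rewrite leqNgt; apply/negP; rewrite gtn_max => /andP[_ sys].
have := many_common_divisors core d0 C0 c00 Delta0 s0 n01 uys ysI ysg sys.
have q0 : (0 < coprime_part c0 (U a))%N by apply: part_gt0.
move/(ler_ln_nat R q0); rewrite ln_natX ?muln_gt0 ?expn_gt0 ?C0 //.
rewrite ln_natM ?expn_gt0 ?C0 // ln_natX // -/E => le1.
have := absorb a Na; have a0 : 0 < a%:R :> R by rewrite ltr0n (leq_ltn_trans _ Na).
move: le1; rewrite -[(a %/ h).+1%:R]natr1.
have := mulr_gt0 delta0 a0; move: ga.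
move: (ln (coprime_part _ _)%:R) => L; nra.
Qed.

(** * Multiplicative dependence and divisibility *)

(* [i] is an index at which the absolute value of the exponent is maximal. *)
Lemma mult_dependent_dvdn (F : numFieldType) s (g : 'I_s -> int) :
  mult_dependent (fun i => (g i)%:~R : F) ->
  (forall i, 0 < `|g i|)%N /\
  exists i, (`|g i| %| \prod_(j | j != i) `|g j|)%N.
Proof.
move=> [g0 [k [i0 ki0] kprod]].
have {}g0 i : (0 < `|g i|)%N by have := g0 i; rewrite intr_eq0 absz_gt0.
split=> //; have [i _ imax] := arg_maxnP (fun i => `|k i|%N) (isT : xpredT i0).
have ki : (0 < `|k i|)%N by apply: leq_trans (imax i0 isT); rewrite absz_gt0.
(* Factors with negative exponent are moved to the other side, which gives an identity of natural
   numbers. *)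
have E : (\prod_(j | (0 <= k j)%R) `|g j| ^ `|k j| = \prod_(j | ~~ (0 <= k j)%R) `|g j| ^ `|k j|)%N.
  pose A (P : pred 'I_s) := \prod_(j | P j) g j ^+ `|k j|.
  have : A (fun j => 0 <= k j) = A (fun j => ~~ (0 <= k j)).
    apply: (@intr_inj F); rewrite !rmorph_prod /=.
    have B0 : \prod_(j | ~~ (0 <= k j)) (g j ^+ `|k j|)%:~R != 0 :> F.
      by apply/prodf_neq0 => j _; rewrite intr_eq0 expf_neq0 // -absz_gt0.
    apply: (mulIf (invr_neq0 B0)); rewrite divff // -[RHS]kprod.
    rewrite [RHS](bigID (fun j => 0 <= k j)) /=; congr (_ * _).
      apply: eq_bigr => j kj; rewrite rmorphXn /=.
      by rewrite -[in RHS](gez0_abs kj).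
    rewrite -prodfV; apply: eq_bigr => j kj.
    have kE : k j = - (`|k j|%N%:Z) by move: kj; lia.
    by rewrite rmorphXn /= [in RHS]kE -exprnN.
  move/(congr1 absz); rewrite /A !(big_morph absz abszM (erefl _)).
  by under eq_bigr do rewrite abszX; under [X in _ = X]eq_bigr do rewrite abszX.
exists i; apply: dvdn_of_logn => // [|p p_pr]; first exact: prodn_gt0.
rewrite logn_prod // -(leq_pmul2l ki) big_distrr /=.
have /(congr1 (logn p)) := E; rewrite !logn_prod => [|j _|j _]; rewrite ?expn_gt0 ?g0 //.
under eq_bigr do rewrite lognX; under [X in _ = X]eq_bigr do rewrite lognX.
move=> {}E.
(* The side of the valuation identity that lacks [i] is bounded by means of [|k j| <= |k i|];
   afterwards [|k i|] cancels. *)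
have le (P : pred 'I_s) : ~~ P i -> (\sum_(j | P j) `|k j| * logn p `|g j|
    <= \sum_(j < s | j != i) `|k i| * logn p `|g j|)%N.
  move=> Pi; rewrite big_mkcond [X in (_ <= X)%N]big_mkcond; apply: leq_sum => j _.
  case: (eqVneq j i) => [->|ji] /=; first by rewrite (negPf Pi).
  by case: (P j) => //; rewrite leq_mul2r (imax j isT : is_true (_ <= _)%N) orbT.
have [ki0'|kin] := boolP (0 <= k i).
  apply: leq_trans (le (fun j => ~~ (0 <= k j)) _); last by rewrite negbK.
  by rewrite -E (bigD1 i) //= leq_addr.
apply: leq_trans (le (fun j => 0 <= k j) kin).
by rewrite E (bigD1 i) //= leq_addr.
Qed.

Lemma gcdn_prod_dvdn (I : finType) (P : pred I) (a : nat) (b : I -> nat) :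
  (a %| \prod_(j | P j) b j)%N -> (a %| \prod_(j | P j) gcdn a (b j))%N.
Proof.
move=> adv; suff : (gcdn a (\prod_(j | P j) b j) %| \prod_(j | P j) gcdn a (b j))%N.
  by apply: dvdn_trans; rewrite dvdn_gcd dvdnn.
elim/big_rec2: _ => [|j x y _ IH]; first by rewrite gcdn1.
apply: (@dvdn_trans (gcdn a (b j) * gcdn a y)); last exact: dvdn_mul.
rewrite muln_gcdr dvdn_gcd dvdn_mull ?dvdn_gcdl //=.
rewrite muln_gcdl dvdn_gcd dvdn_mulr ?dvdn_gcdl //= dvdn_gcdr //.
Qed.

Lemma gcdn_coprime_part c0 a n : (0 < c0)%N -> (0 < n)%N ->
  gcdn (coprime_part c0 a) n = gcdn (coprime_part c0 a) (coprime_part c0 n).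
Proof.
move=> c00 n0; rewrite -{1}(partnC \pi(c0) n0) Gauss_gcdr //.
by apply: pnat_coprime (part_pnat _ _) _; rewrite pnatNK part_pnat.
Qed.

(** [q] divides the product of its [s - 1] gcds with the other terms. If all their [s]-th powers
    were below [q], then [q ^ s <= q ^ (s - 1)], impossible for [q > 1]. *)
Lemma large_gcd_of_dvdn s c0 (x : 'I_s -> nat) i :
  (0 < c0)%N -> (forall j, 0 < x j)%N -> (x i %| \prod_(j | j != i) x j)%N ->
  (1 < coprime_part c0 (x i))%N ->
  exists2 j, j != i &
   (coprime_part c0 (x i) <= gcdn (coprime_part c0 (x i)) (coprime_part c0 (x j)) ^ s)%N.
Proof.
move=> c00 x0 xdvd q1; set q := coprime_part c0 (x i) in q1 *.
have /gcdn_prod_dvdn : (q %| \prod_(j | j != i) x j)%N by apply: dvdn_trans xdvd; apply: dvdn_part.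
under eq_bigr do rewrite gcdn_coprime_part //.
have gt0 j : (0 < gcdn q (coprime_part c0 (x j)))%N by rewrite gcdn_gt0 (ltnW q1).
have s0 : (0 < s)%N by apply: leq_ltn_trans (ltn_ord i).
have gp : (0 < \prod_(j | j != i) gcdn q (coprime_part c0 (x j)))%N by apply: prodn_cond_gt0.
move/(dvdn_leq gp) => le.
have [/exists_inP[j ji jle]|] := boolP [exists (j | j != i), (q <= gcdn q (coprime_part c0 (x j)) ^ s)%N].
  by exists j.
rewrite negb_exists_in => /forall_inP H.
have : (q ^ s <= q ^ s.-1)%N.
  have : (q ^ s <= (\prod_(j | j != i) gcdn q (coprime_part c0 (x j))) ^ s)%N by rewrite leq_exp2r.
  move=> /leq_trans; apply.
  rewrite (big_morph (fun m => m ^ s)%N (fun a b => expnMn a b s) (exp1n s)).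
  apply: leq_trans (_ : \prod_(j < s | j != i) q <= _)%N.
    by apply: leq_prod => j ji; have := H j ji; rewrite -ltnNge => /ltnW.
  rewrite prod_nat_const leq_pexp2l ?(ltnW q1) //.
  by have := cardC1 i; rewrite card_ord => E; rewrite -[X in (_ <= X)%N]E; apply: eq_leq; apply: eq_card => j; rewrite !inE.
by rewrite leq_exp2l // -ltnS prednK // ltnn.
Qed.

(** * Counting tuples *)

Lemma count_iota_le (P : pred nat) m k n : (k <= n)%N ->
  (count P (iota m k) <= count P (iota m n))%N.
Proof. by move=> kn; rewrite -(subnKC kn) iotaD count_cat leq_addr. Qed.

Lemma count_pieces (P : pred nat) K L m0 n : (0 < L)%N ->
  (forall m, (m0 <= m)%N -> (count P (iota m L) <= K)%N) ->
  (count P (iota m0 n) <= K * (n %/ L).+1)%N.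
Proof.
move=> L0; elim/ltn_ind: n m0 => n IH m0 H; have [nL|Ln] := ltnP n L.
  rewrite divn_small // muln1 (leq_trans (count_iota_le _ _ (ltnW nL))) // H //.
rewrite -{1}(subnKC Ln) iotaD count_cat -{2}(subnKC Ln) divnDl ?dvdnn // divnn L0 add1n mulnS.
rewrite leq_add ?H // IH; first by [].
  by rewrite -subn_gt0 subKn.
by move=> m mL; apply: H; apply: leq_trans mL; apply: leq_addr.
Qed.

Lemma halving_bound (R : numDomainType) (f : nat -> R) (c : R) : 0 <= c -> f 0%N <= 0 ->
  (forall N, (0 < N)%N -> f N <= f N./2 + c) ->
  forall N, f N <= c * (trunc_log 2 N).+1%:R.
Proof.
move=> c0 f0 step N; elim/ltn_ind: N => N IH.
have [->|N0] := posnP N; first by rewrite (le_trans f0) // mulr_ge0.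
have [N1|N1] := leqP N 1.
  have -> : N = 1%N by apply/eqP; rewrite eqn_leq N1.
  apply: le_trans (step 1%N isT) _; rewrite trunc_log1 mulr1.
  by rewrite -[leRHS]add0r lerD2r.
have lt : (N./2 < N)%N by rewrite -divn2 ltn_Pdiv.
rewrite trunc_log2S // (le_trans (step N N0)) // mulrS mulrDr mulr1 addrC lerD2l.
exact: IH.
Qed.

(** In the upper half of the range every point is at least [N / 2], whatever [M] is, so [O(h)]
    pieces of proportional length cover it. Repeated halving gives the logarithm. *)
Lemma count_bad_le (bad : pred nat) K h M N : (0 < h)%N ->
  (forall m, (1 <= m)%N -> (count bad (iota m (m %/ h).+1) <= K)%N) ->
  (count bad (iota M.+1 N) <= K * h * (trunc_log 2 N).+1)%N.
Proof.
move=> h0 H.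
have := @halving_bound int (fun N => (count bad (iota M.+1 N))%:R) (K * h)%:R (ler0n _ _) (lexx _) _ N.
rewrite -natrM ler_nat; apply => {}N N0.
rewrite -natrD ler_nat -{1}(odd_double_half N) -addnn addnCA iotaD count_cat leq_add2l.
set m0 := (M.+1 + N./2)%N; set L := (m0 %/ h).+1.
apply: (@leq_trans (K * ((odd N + N./2) %/ L).+1)).
  apply: count_pieces => // m mm0; apply: leq_trans (H m _); last by apply: leq_trans mm0.
  by apply: count_iota_le; rewrite ltnS leq_div2r.
rewrite leq_mul2l; apply/orP; right.
rewrite ltn_divLR // mulnC /L.
have := ltn_ceil m0 h0; rewrite /m0; case: (odd N); lia.
Qed.

Lemma harmonic_le (R : realFieldType) N :
  \sum_(i < N) (i.+1%:R)^-1 <= (trunc_log 2 N).+1%:R :> R.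
Proof.
rewrite -[leRHS]mul1r; apply: (halving_bound (f := fun N => \sum_(i < N) (i.+1%:R)^-1)) => // [|{}N N0].
  by rewrite big_ord0.
rewrite -!(big_mkord xpredT (fun i => (i.+1%:R)^-1)).
have hN : (N./2 <= N)%N by rewrite -divn2 leq_div.
rewrite [leLHS](big_cat_nat (n := N./2)) //= lerD2l.
apply: le_trans (_ : \sum_(N./2 <= i < N) (N./2.+1%:R)^-1 <= _).
  rewrite big_nat [leRHS]big_nat; apply: ler_sum => i /andP[hi _].
  by rewrite lef_pV2 ?posrE ?ltr0n // ler_nat ltnS.
rewrite sumr_const_nat -[_ *+ _]mulr_natl ler_pdivrMr ?ltr0n // mul1r ler_nat.
by have := odd_double_half N; rewrite -addnn; case: (odd N); lia.
Qed.

(** [h * ((M.+1 + i) %/ h).+1] is at least [i.+1], so each term is at most [h * N / i.+1 + 1]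
    independently of [M], and the harmonic sum remains. *)
Lemma partner_sum_le (R : realFieldType) h M N : (0 < h)%N -> (0 < N)%N ->
  \sum_(i < N) (N %/ ((M.+1 + i) %/ h).+1).+1%:R
    <= (2 * h * N)%:R * (trunc_log 2 N).+1%:R :> R.
Proof.
move=> h0 N0; set t := (trunc_log 2 N).+1.
apply: (@le_trans _ _ (\sum_(i < N) ((h * N)%:R * (i.+1%:R)^-1 + 1))).
  apply: ler_sum => i _; rewrite -natr1 lerD2r ler_pdivlMr ?ltr0n // -natrM ler_nat.
  set L := (_ %/ h).+1.
  have iL : (i.+1 <= h * L)%N.
    by have := ltn_ceil (M.+1 + i) h0; rewrite -/L; lia.
  apply: leq_trans (leq_mul (leqnn _) iL) _.
  by rewrite mulnCA leq_mul2l leq_divM orbT.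
rewrite big_split /= sumr_const card_ord -mulr_sumr.
have t1 : 1 <= t%:R :> R by rewrite ler1n.
have hN : N%:R <= (h * N)%:R :> R by rewrite ler_nat leq_pmull.
have hN0 : 0 <= (h * N)%:R :> R by [].
have := ler_wpM2l hN0 (harmonic_le R N); rewrite -/t.
have -> : (2 * h * N)%:R = 2 * (h * N)%:R :> R by rewrite -mulnA natrM.
move: (\sum_(i < N) _) => S; move: (h * N)%:R hN hN0 => X *; nra.
Qed.

Lemma leq_card_cover (X I : finType) (A : {set X}) (F : I -> {set X}) :
  (forall x, x \in A -> exists i, x \in F i) -> (#|A| <= \sum_i #|F i|)%N.
Proof.
move=> H; apply: (@leq_trans #|\bigcup_i F i|).
  by apply: subset_leq_card; apply/fintype.subsetP => x /H[i xi]; apply/bigcupP; exists i.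
elim/big_rec2: _ => [|i m B _ IH]; first by rewrite cards0.
by rewrite (leq_trans (leq_card_setU _ _)) // leq_add2l.
Qed.

Lemma card_ord_count (P : pred nat) M N :
  #|[set x : 'I_(M + N).+1 | (M < x)%N && P x]| = count P (iota M.+1 N).
Proof.
transitivity (\sum_(0 <= x < (M + N).+1 | (M < x)%N && P x) 1)%N.
  by rewrite big_mkord -sum1_card; apply: eq_bigl => x; rewrite inE.
rewrite sum1_count /index_iota subn0 -addSn iotaD count_cat add0n.
rewrite (@eq_in_count _ _ pred0) ?count_pred0 => [|x]; last first.
  by rewrite mem_iota add0n ltnS /= => xM; rewrite ltnNge xM.
by apply: eq_in_count => x; rewrite mem_iota => /andP[->].
Qed.

Lemma sum_ord_shift (R : nmodType) (g : nat -> R) M N :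
  \sum_(a < (M + N).+1 | (M < a)%N) g a = \sum_(i < N) g (M.+1 + i)%N.
Proof.
rewrite big_mkcond /=; elim: N => [|N IH].
  by rewrite addn0 big_ord0 big1 // => a _; rewrite ltnNge -ltnS ltn_ord.
by rewrite addnS big_ord_recr [RHS]big_ord_recr /= IH ltnS leq_addr addSn.
Qed.

Lemma card_ffun_family (I T : finType) (F : I -> {set T}) :
  #|[set n : {ffun I -> T} | [forall l, n l \in F l]]| = (\prod_l #|F l|)%N.
Proof.
transitivity #|(family (fun l => mem (F l)) : simpl_pred {ffun I -> T})|.
  by apply: eq_card => n; rewrite inE; apply/forallP/familyP.
by rewrite card_family foldrE big_map big_enum.
Qed.

(** Union bound over the bad coordinate [i] ([FA]), or over [i], [j] and the value [a] at [i]
    ([FB]). A bad coordinate has [O(log N)] values instead of [N]; the partners of [a] are counted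
    by pieces of length [(a %/ h).+1] and summed over [a]. *)
Lemma tuple_count (R : realFieldType) s M N (T : {set {ffun 'I_s -> 'I_(M + N).+1}})
    (bad : pred nat) (pair : rel nat) K h :
  (0 < h)%N -> (0 < N)%N ->
  (forall m, (1 <= m)%N -> (count bad (iota m (m %/ h).+1) <= K)%N) ->
  (forall a m, (1 <= m)%N -> (count (pair a) (iota m (a %/ h).+1) <= K)%N) ->
  (forall n, n \in T -> (forall i, (M < n i)%N) /\
     exists i, bad (n i) \/ exists2 j, j != i & pair (n i) (n j)) ->
  #|T|%:R <= ((s + 2 * s * s) * K * h)%:R * (trunc_log 2 N).+1%:R * N%:R ^+ s.-1 :> R.
Proof.
move=> h0 N0 Hbad Hpair HT; set t := (trunc_log 2 N).+1.
pose J P := [set x : 'I_(M + N).+1 | (M < x)%N && P (x : nat)].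
have cJ : #|J predT| = N by rewrite card_ord_count count_predT size_iota.
pose fam (F : 'I_s -> {set 'I_(M + N).+1}) := [set n : {ffun 'I_s -> 'I_(M + N).+1} | [forall l, n l \in F l]].
pose FA i := fam (fun l => if l == i then J bad else J predT).
pose FB (x : 'I_s * 'I_s * 'I_(M + N).+1) := let: (i, j, a) := x in
  if (j != i) && (M < a)%N then
    fam (fun l => if l == i then [set a] else if l == j then J (pair a) else J predT)
  else finset.set0.
pose F (x : 'I_s + 'I_s * 'I_s * 'I_(M + N).+1) :=
  match x with inl i => FA i | inr y => FB y end.
have cover : (#|T| <= \sum_x #|F x|)%N.
  apply: leq_card_cover => n /HT[nM [i [bi|[j ji pij]]]].
    exists (inl i); rewrite /= inE; apply/forallP => l.
    by case: eqP => [->|_]; rewrite inE nM.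
  exists (inr (i, j, n i)); rewrite /= ji nM inE; apply/forallP => l.
  case: eqP => [->|_]; first by rewrite inE.
  by case: eqP => [->|_]; rewrite inE nM.
have cI (i : 'I_s) : #|[pred l | l != i]| = s.-1.
  by have := cardC1 i; rewrite card_ord => <-; apply: eq_card => l; rewrite !inE.
have cFA i : (#|FA i| <= K * h * t * N ^ s.-1)%N.
  rewrite /FA /fam card_ffun_family (bigD1 i) //= eqxx leq_mul //.
    by rewrite card_ord_count count_bad_le.
  rewrite (eq_bigr (fun=> N)) => [|l li]; last by rewrite (negPf li) cJ.
  by rewrite prod_nat_const cI.
have cFB i j : (\sum_a #|FB (i, j, a)|)%:R <= (2 * K * h)%:R * t%:R * N%:R ^+ s.-1 :> R.
  have [ji|ji] := eqVneq j i.
    rewrite (eq_bigr (fun=> 0%N)) => [|a _]; last by rewrite /FB ji eqxx cards0.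
    by rewrite big1_eq !mulr_ge0 ?exprn_ge0.
  rewrite (bigID (fun a : 'I_(M + N).+1 => (M < a)%N)) /= [X in (_ + X)%N]big1 ?addn0; last first.
    by move=> a /negPf Ma; rewrite Ma andbF cards0.
  have cij : #|[pred l : 'I_s | (l != i) && (l != j)]| = s.-2.
    rewrite -(cI i) [in RHS](cardD1 j) inE ji add1n /=.
    by apply: eq_card => l; rewrite !inE andbC.
  have s2 : (1 < s)%N.
    by have := ltn_ord i; have := ltn_ord j; move: ji; rewrite -val_eqE /=; lia.
  apply: (@le_trans _ _ (\sum_(a < (M + N).+1 | (M < a)%N)
      (K * (N %/ (a %/ h).+1).+1 * N ^ s.-2)%:R)).
    rewrite natr_sum; apply: ler_sum => a Ma; rewrite ler_nat ji Ma /=.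
    rewrite /fam card_ffun_family (bigD1 i) //= eqxx cards1 mul1n (bigD1 j) //= (negPf ji) eqxx.
    rewrite leq_mul //.
      rewrite card_ord_count; apply: count_pieces => // m mM; apply: Hpair; exact: leq_trans mM.
    rewrite (eq_bigr (fun=> N)) => [|l /andP[li lj]]; last by rewrite (negPf li) (negPf lj) cJ.
    by rewrite prod_nat_const cij.
  rewrite (sum_ord_shift (fun a => (K * (N %/ (a %/ h).+1).+1 * N ^ s.-2)%:R)).
  under eq_bigr do rewrite mulnAC natrM.
  rewrite -mulr_sumr; have := partner_sum_le R M h0 N0; rewrite -/t => le.
  apply: le_trans (ler_wpM2l (ler0n _ _) le) _.
  have -> : N%:R ^+ s.-1 = N%:R * N%:R ^+ s.-2 :> R by rewrite -exprS; congr (_ ^+ _); lia.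
  by rewrite !natrM natrX le_eqVlt; apply/orP; left; apply/eqP; ring.
apply: (@le_trans _ _ (\sum_x #|F x|)%:R); first by rewrite ler_nat.
rewrite big_sumType /= natrD (eq_bigr (fun y => #|FB (y.1.1, y.1.2, y.2)|)) => [|[[i j] a] _] //.
rewrite -(pair_bigA _ (fun p a => #|FB (p.1, p.2, a)|)) /=.
have leA : (\sum_i #|FA i|)%:R <= s%:R * ((K * h)%:R * t%:R * N%:R ^+ s.-1) :> R.
  rewrite -natrX -!natrM ler_nat -[X in (_ <= X * _)%N]card_ord -sum_nat_const.
  by apply: leq_sum => i _; apply: cFA.
have leB : (\sum_p \sum_a #|FB (p.1, p.2, a)|)%:R
    <= (s * s)%:R * ((2 * K * h)%:R * t%:R * N%:R ^+ s.-1) :> R.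
  rewrite natr_sum -[X in (X * X)%N]card_ord -card_prod mulr_natl -sumr_const.
  by apply: ler_sum => p _; apply: cFB.
apply: le_trans (lerD leA leB) _.
by rewrite !natrM natrD !natrM le_eqVlt; apply/orP; left; apply/eqP; ring.
Qed.

(** The exponent [2 / 5 = 1 - 3 / 5] is the room left by [3 / (4d - 3) <= 3 / 5]. *)
Lemma trunc_log_le_powR (R : realType) :
  exists2 c : R, 0 < c & forall N, (1 <= N)%N ->
    (trunc_log 2 N).+1%:R <= c * N%:R `^ (2 / 5).
Proof.
have ln2 : 0 < ln (2 : R) by rewrite ln_gt0 // ltr1n.
exists (5 / 2 / ln 2 + 1); first by rewrite ltr_wpDl // !divr_ge0 // ltW.
move=> N N1; set x := _ `^ _.
have NR : 1 <= N%:R :> R by rewrite ler1n.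
have x1 : 1 <= x by rewrite -(powRr0 N%:R) ler_powR // divr_ge0.
have lnN : ln (N%:R : R) <= 5 / 2 * x.
  have := ln_sublinear (lt_le_trans ltr01 x1); rewrite ln_powR => H.
  have e : ln (N%:R : R) = 5 / 2 * (2 / 5 * ln N%:R) by field.
  by rewrite e ler_wpM2l // ltW.
have : (trunc_log 2 N)%:R * ln 2 <= ln (N%:R : R).
  by rewrite -ln_natX // ler_ln_nat ?expn_gt0 // trunc_logP.
rewrite -ler_pdivlMr // => H; rewrite -natr1 mulrDl mul1r lerD //.
apply: le_trans H _; rewrite ler_pdivrMr // mulrAC divfK ?gt_eqF //.
Qed.

(** * Assembly of the count and the final exponent *)

Lemma num_mult_dependent_le (R : realType) (u : nat -> int) (n : nat) (c : 'I_n.+2 -> int)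
    (hu : int_lrs_of_order u c)
    (hsimple : simple_poly R (char_polynomial c))
    (hnondeg : non_degenerate_poly R (char_polynomial c))
    (hdom : has_dominant_root R (char_polynomial c))
    (s : nat) (hs : (1 <= s)%N) :
  exists A : nat, forall M N : nat, (1 <= N)%N ->
    (num_mult_dependent R u s M N)%:R
      <= A%:R * (trunc_log 2 N).+1%:R * N%:R ^+ s.-1 :> R.
Proof.
pose U y := `|u y|%N; pose c0 := `|c ord0|%N.
have c0_neq0 : c ord0 != 0 by have [] := hnondeg; rewrite char_polynomial_coef0 oppr_eq0.
have c0_gt0 : (0 < c0)%N by rewrite absz_gt0.
have [B [C [Delta [C0 Delta0 core]]]] := lrs_divisors_and_size hu hsimple hnondeg.
have {}core : lrs_core n.+2 c0 B C Delta U by move=> *; apply: core.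
have [l [b [l0 b0 cl growth]]] := lrs_growth hu hsimple c0_neq0 hdom.
have {}cl : c0%:R < l ^+ n.+2 by rewrite pmulrn abszE.
have {}growth k : (1 <= k)%N -> b * l ^+ k <= \sum_(j < n.+2) (U (k + j)%N)%:R.
  by move=> /growth /le_trans; apply; apply: ler_sum => j _; rewrite pmulrn abszE.
have [delta [delta0 [K1 [h1 [h10 Hbad]]]]] :=
  few_bad_terms core isT C0 c0_gt0 Delta0 l0 b0 cl growth.
have [K2 [h2 [h20 Hpart]]] := few_partners core isT C0 c0_gt0 Delta0 hs delta0.
pose q y := coprime_part c0 (U y).
pose bad y := (U y == 0%N) || (ln (q y)%:R < delta * y%:R).
(* The gcd condition is the one produced by [large_gcd_of_dvdn]; excluding bad [x] supplies the
   lower bound for [q x] that [few_partners] requires. *)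
pose pair x y := ~~ bad x && (q x <= gcdn (q x) (q y) ^ s)%N.
(* A common multiple [h] gives intervals contained in those of both scales. *)
pose K := maxn K1 K2; pose h := (h1 * h2)%N.
have h0 : (0 < h)%N by rewrite muln_gt0 h10.
have count_filter_le (P : pred nat) m k h' : (0 < h')%N -> (h' %| h)%N ->
    (count P (iota m (k %/ h).+1) <= count P (iota m (k %/ h').+1))%N.
  move=> h'0 h'h; apply: count_iota_le; rewrite ltnS.
  by rewrite leq_div2l // dvdn_leq.
have iotaE m k y : y \in iota m k.+1 -> (m <= y <= m + k)%N.
  by rewrite mem_iota addnS ltnS.
exists ((s + 2 * s * s) * K * h)%N => M N N1; apply: (@tuple_count R s M N _ bad pair K h) => //.
- move=> m m1; apply: leq_trans (count_filter_le bad m m h1 h10 (dvdn_mulr _ (dvdnn _))) _.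
  rewrite leq_max -size_filter; apply/orP; left.
  apply: (Hbad m) => //; first by rewrite filter_uniq ?iota_uniq.
    by move=> y; rewrite mem_filter => /andP[_ /iotaE].
  by move=> y; rewrite mem_filter => /andP[/orP[/eqP|] + _]; [left|right].
- move=> a m m1; have [ba|nba] := boolP (bad a).
    by rewrite (eq_count (a2 := pred0)) ?count_pred0 // => y; rewrite /pair /= ba.
  apply: leq_trans (count_filter_le (pair a) m a h2 h20 (dvdn_mull _ (dvdnn _))) _.
  rewrite leq_max -size_filter; apply/orP; right.
  apply: (Hpart a m) => //; first by move: nba; rewrite negb_or -leNgt => /andP[].
  - by rewrite filter_uniq ?iota_uniq.
  - by move=> y; rewrite mem_filter => /andP[_ /iotaE].
  by move=> y; rewrite mem_filter => /andP[/andP[]].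
move=> v; rewrite inE => /andP[/forallP vM /asboolP /mult_dependent_dvdn[v0 [i idvd]]].
split; first by move=> j; have := vM j; rewrite addn1.
exists i; have [bi|nbi] := boolP (bad (v i)); first by left.
(* If [q (v i)] were 1, its logarithm 0 would lie below [delta * v i], and [v i] would be bad. *)
right; have q1 : (1 < q (v i))%N.
  have q0 : (0 < q (v i))%N by apply: part_gt0.
  rewrite ltn_neqAle q0 andbT eq_sym; apply: contra nbi => /eqP q1.
  by rewrite /bad q1 ln1 mulr_gt0 ?orbT // ltr0n (leq_trans _ (vM i)) // addn1.
have [j ji jq] := large_gcd_of_dvdn c0_gt0 v0 idvd q1.
by exists j => //; rewrite /pair nbi.
Qed.

Local Open Scope classical_set_scope.

Theorem mainTheorem4 (R : realType) (u : nat -> int) (d : nat)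
    (c : 'I_d -> int)
    (hd : (2 <= d)%N)
    (hu : int_lrs_of_order u c)
    (hsimple : simple_poly R (char_polynomial c))
    (hnondeg : non_degenerate_poly R (char_polynomial c))
    (hdom : has_dominant_root R (char_polynomial c))
    (s : nat) (hs : (1 <= s)%N) :
  exists (C : R) (eps : nat -> R),
    [/\ 0 < C,
        eps n @[n --> \oo] --> (0 : R) &
        forall M N : nat, (1 <= N)%N ->
          (num_mult_dependent R u s M N)%:R
            <= C * N%:R `^ (s%:R - 3 / (4 * d%:R - 3) + eps N)].
Proof.
case: d c hd hu hsimple hnondeg hdom => [//|[//|n]] c _ hu hsimple hnondeg hdom.
have [A HA] := num_mult_dependent_le hu hsimple hnondeg hdom hs.
have [k k0 Hk] := trunc_log_le_powR R.
(* The bound [N ^ (s - 1) log N] is strong enough for a zero error exponent; the summand 1 keeps the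
   constant positive when [A = 0]. *)
exists (A%:R * k + 1), (fun=> 0); split; first by rewrite ltr_wpDl // mulr_ge0 // ltW.
  exact: cvg_cst.
move=> M N N1; apply: le_trans (HA M N N1) _.
have NR : 1 <= N%:R :> R by rewrite ler1n.
rewrite addr0; set e := _ - _.
(* For [d >= 2], [4d - 3 >= 5], so [e >= s - 3 / 5]. *)
have ee : s.-1%:R + 2 / 5 <= e.
  have -> : s.-1%:R = s%:R - 1 :> R by rewrite -[in RHS](prednK hs) -natr1 addrK.
  rewrite /e -addrA lerD2l.
  have d5 : 5 <= 4 * n.+2%:R - 3 :> R.
    have n2 : 2 <= n.+2%:R :> R by rewrite ler_nat.
    by move: n2; lra.
  suff : 3 / (4 * n.+2%:R - 3) <= 3 / 5 :> R by lra.
  by rewrite ler_pM2l // lef_pV2 ?posrE //; lra.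
have N0 : (N%:R : R) != 0 by rewrite pnatr_eq0 -lt0n.
have le1 : N%:R ^+ s.-1 * N%:R `^ (2 / 5) <= N%:R `^ e.
  by rewrite -powR_mulrn // -powRD ?N0 ?implybT // ler_powR.
have P0 : 0 <= N%:R ^+ s.-1 :> R by rewrite exprn_ge0.
apply: (@le_trans _ _ (A%:R * k * (N%:R ^+ s.-1 * N%:R `^ (2 / 5)))).
  have := ler_wpM2l (ler0n R A) (Hk N N1) => /(fun H => ler_wpM2r P0 H) /le_trans; apply.
  by rewrite le_eqVlt; apply/orP; left; apply/eqP; ring.
apply: (@le_trans _ _ (A%:R * k * N%:R `^ e)); first by rewrite ler_wpM2l // mulr_ge0 // ltW.
by rewrite ler_wpM2r ?powR_ge0 // lerDl.
Qed.
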